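(* When all the $d_{ij}$ values are uniform (all equal to one common value) and there are at most two distinct $r_{ij}$ values (say $a$ and $b$), a minimum-diameter-cost spanning tree can be computed in polynomial time.
   Context: An instance consists of a set of nodes together with a nonnegative distance value $d_{ij}$ and a nonnegative requirement value $r_{ij}$ for every pair of nodes $i,j$. The diameter cost of a spanning tree (of the complete graph on the nodes) is the maximum over all pairs of nodes $i,j$ of the product of $r_{ij}$ and the distance between $i$ and $j$ in the tree, where this distance is the sum of the $d$ values of the edges on the tree path from $i$ to $j$. A minimum-diameter-cost spanning tree is a spanning tree minimizing this cost. *)

(* Defs.v *)
From mathcomp Require Import all_boot all_order all_algebra.

Set Implicit Arguments.
Unset Strict Implicit.
Unset Printing Implicit Defensive.

Import Order.TTheory GRing.Theory Num.Theory.

(* The machine model is the random access machine with the logarithmic cost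
   criterion (Aho, Hopcroft and Ullman), presented with structured control
   flow.  The memory is a family of unbounded arrays of natural numbers; a
   program mentions only finitely many of them, and cell 0 of an array can serve
   as a scalar variable.  Every operation is charged the bit lengths of all the
   numbers it handles, addresses included, so running time is polynomially
   related to that of a Turing machine. *)

Definition memory : Type := nat -> nat -> nat.

Definition store (m : memory) (a i v : nat) : memory :=
  fun a' i' => if (a' == a) && (i' == i) then v else m a' i'.

Definition bitlen (x : nat) : nat := (trunc_log 2 x).+1.

Definition bitsize (w : seq nat) : nat := \sum_(x <- w) bitlen x.

Inductive binop : Type := Add | Sub | Mul | Div.

Definition eval_binop (o : binop) : nat -> nat -> nat :=
  match o with
  | Add => addn
  | Sub => subn
  | Mul => muln
  | Div => divn
  end.

Inductive expr : Type :=
| Const (c : nat)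
| Read (a : nat) (e : expr)
| Bin (o : binop) (e1 e2 : expr).

Fixpoint eval (m : memory) (e : expr) : nat :=
  match e with
  | Const c => c
  | Read a e1 => m a (eval m e1)
  | Bin o e1 e2 => eval_binop o (eval m e1) (eval m e2)
  end.

Fixpoint eval_cost (m : memory) (e : expr) : nat :=
  match e with
  | Const c => bitlen c
  | Read a e1 =>
      eval_cost m e1 + bitlen (eval m e1) + bitlen (m a (eval m e1))
  | Bin o e1 e2 =>
      eval_cost m e1 + eval_cost m e2
      + bitlen (eval m e1) + bitlen (eval m e2)
  end.

Inductive program : Type :=
| Skip
| Write (a : nat) (e1 e2 : expr)
| Seq (p1 p2 : program)
| If (e : expr) (p1 p2 : program)
| While (e : expr) (p : program).

Definition test_cost (m : memory) (e : expr) : nat :=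
  eval_cost m e + bitlen (eval m e).

(* [exec p m m' t]: started in memory [m], program [p] halts in memory [m']
   after time [t].  A test succeeds when its value is nonzero. *)
Inductive exec : program -> memory -> memory -> nat -> Prop :=
| ExecSkip m : exec Skip m m 1
| ExecWrite a e1 e2 m :
    exec (Write a e1 e2) m (store m a (eval m e1) (eval m e2))
         (test_cost m e1 + test_cost m e2)
| ExecSeq p1 p2 m m1 m2 t1 t2 :
    exec p1 m m1 t1 -> exec p2 m1 m2 t2 -> exec (Seq p1 p2) m m2 (t1 + t2)
| ExecIfTrue e p1 p2 m m' t :
    eval m e != 0 -> exec p1 m m' t ->
    exec (If e p1 p2) m m' (test_cost m e + t)
| ExecIfFalse e p1 p2 m m' t :
    eval m e = 0 -> exec p2 m m' t ->
    exec (If e p1 p2) m m' (test_cost m e + t)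
| ExecWhileTrue e p m m1 m2 t1 t2 :
    eval m e != 0 -> exec p m m1 t1 -> exec (While e p) m1 m2 t2 ->
    exec (While e p) m m2 (test_cost m e + t1 + t2)
| ExecWhileFalse e p m :
    eval m e = 0 -> exec (While e p) m m (test_cost m e).

Lemma exec_deterministic p m m1 m2 t1 t2 :
  exec p m m1 t1 -> exec p m m2 t2 -> m1 = m2 /\ t1 = t2.
Proof.
move=> H; elim: H m2 t2 => {p m m1 t1} *;
  match goal with H : exec _ _ _ _ |- _ => inversion H; subst; clear H end;
  repeat match goal with
  | IH : forall m t, exec ?p ?x m t -> _ /\ _, H : exec ?p ?x _ _ |- _ =>
      case: (IH _ _ H) => ? ?; subst; clear H
  | H : is_true (?x != 0), E : ?x = 0 |- _ => by rewrite E in H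
  end; by [].
Qed.

(* A word occupies an array with its length in cell 0 and its letters in the
   following cells.  The input is in array 0, the output in array 1, and all
   other cells are initially 0. *)

Definition load_input (w : seq nat) : memory :=
  fun a i => if a == 0 then nth 0 (size w :: w) i else 0.

Definition read_output (m : memory) : seq nat :=
  mkseq (fun i => m 1 i.+1) (m 1 0).

(* One fixed program solves, in time polynomial in the bit size of the input,
   the search problem [sol] on the inputs that satisfy [promise]. *)
Definition poly_time_solvable (X : Type) (encode : X -> seq nat)
    (promise : X -> Prop) (sol : X -> seq nat -> Prop) : Prop :=
  exists (p : program) (c k : nat), forall x : X, promise x ->
    exists (m : memory) (t : nat),
      [/\ exec p (load_input (encode x)) m t,
          t <= c * bitsize (encode x) ^ k + c
        & sol x (read_output m)].

Local Open Scope ring_scope.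

Section Trees.

Variable V : finType.

Definition is_spanning_tree (T : rel V) : Prop :=
  [/\ symmetric T,
      irreflexive T,
      forall i j, connect T i j
    & forall c : seq V, ucycle T c -> (size c <= 2)%N].

(* As in path.v, the path consists of [i] followed by [p]. *)
Definition is_simple_path (T : rel V) (i j : V) (p : seq V) : bool :=
  [&& path T i p, last i p == j & uniq (i :: p)].

(* The bound on the length loses nothing, a simple path having at most #|V|
   vertices. *)
Definition tree_path (T : rel V) (i j : V) : seq V :=
  if [pick p : #|V|.-bseq V | is_simple_path T i j p] is Some p then p
  else [::].

Definition tree_dist (d : V -> V -> rat) (T : rel V) (i j : V) : rat :=
  \sum_(w <- pairmap d i (tree_path T i j)) w.

(* All the products are nonnegative on an instance, so the default value 0 is
   only attained as such when there are no pairs. *)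
Definition diameter_cost (d r : V -> V -> rat) (T : rel V) : rat :=
  \big[Num.max/0]_(ij : V * V | ij.1 != ij.2)
    (r ij.1 ij.2 * tree_dist d T ij.1 ij.2).

Definition is_min_diameter_cost_spanning_tree
    (d r : V -> V -> rat) (T : rel V) : Prop :=
  is_spanning_tree T /\
  forall T' : rel V, is_spanning_tree T' ->
    diameter_cost d r T <= diameter_cost d r T'.

End Trees.

(* The values are attached to unordered pairs, whence the symmetry; the diagonal
   values play no role. *)
Record instance : Type := Instance {
  num_nodes : nat;
  dist : 'I_num_nodes -> 'I_num_nodes -> rat;
  req : 'I_num_nodes -> 'I_num_nodes -> rat;
  dist_sym : forall i j, dist i j = dist j i;
  req_sym : forall i j, req i j = req j i;
  dist_ge0 : forall i j, 0 <= dist i j;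
  req_ge0 : forall i j, 0 <= req i j
}.

Definition encode_rat (x : rat) : seq nat := [:: `|numq x|%N; `|denq x|%N].

Definition row_major (A : Type) (n : nat) (f : 'I_n -> 'I_n -> A) : seq A :=
  [seq f i j | i <- enum 'I_n, j <- enum 'I_n].

Definition encode_instance (I : instance) : seq nat :=
  num_nodes I :: flatten [seq encode_rat x | x <- row_major (@dist I)]
          ++ flatten [seq encode_rat x | x <- row_major (@req I)].

Definition encode_graph (n : nat) (T : rel 'I_n) : seq nat :=
  row_major (fun i j => nat_of_bool (T i j)).

Definition uniform_dist (I : instance) : Prop :=
  exists c : rat, forall i j : 'I_(num_nodes I), i != j -> dist i j = c.

Definition at_most_two_req (I : instance) : Prop :=
  exists a b : rat, forall i j : 'I_(num_nodes I), i != j ->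
    req i j = a \/ req i j = b.

Definition encodes_min_tree (I : instance) (w : seq nat) : Prop :=
  exists T : rel 'I_(num_nodes I),
    is_min_diameter_cost_spanning_tree (@dist I) (@req I) T /\
    w = encode_graph T.

(* Main.v *)
Require Import Defs.
From mathcomp Require Import all_boot all_order all_algebra zify.

(* Since d is constant, only the numbers of edges of the tree paths matter.  Let
   b be the largest requirement and G the graph of the pairs of requirement b.
   A tree missing an edge of G costs at least 2b (in units of d), and a star
   costs at most 2b.  A tree containing G exists only if G is a forest; then it
   costs b on the edges of G, and the other pairs, all of the same lower
   requirement, make it best to minimize the diameter.  The diameter is least
   when the centers of the components of G are all joined to the center of a
   component of maximum radius: two components of radii R and R' force a
   diameter at least R + R' + 1, and three components force R + R' + 2 for some
   two of them, because three components pairwise joined by an edge of the tree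
   would close a cycle.

   The program links greedily, as in Kruskal's algorithm, the edges of G and
   then the hub to the centers, maintaining all the distances; it returns the
   result when its cost is at most 2b and a star otherwise.  It consists of
   loops over the nodes and never stores a product, so that a step lengthens
   the numbers in memory by a bounded number of bits; hence it runs in
   polynomial time whatever it computes. *)

Set Implicit Arguments.
Unset Strict Implicit.
Unset Printing Implicit Defensive.

Import Order.TTheory GRing.Theory Num.Theory.

(** * Forests and their distance matrices *)

Section SimplePaths.

Variable V : finType.
Implicit Types (T : rel V) (x y z : V) (p q : seq V).

Definition acyclic T : Prop := forall c : seq V, ucycle T c -> size c <= 2.

Definition hop T x y : nat := size (tree_path T x y).

Lemma simple_pathP T x y p :
  reflect [/\ path T x p, last x p = y & uniq (x :: p)] (is_simple_path T x y p).
Proof. by apply: (iffP and3P) => -[? /eqP ? ?]; split=> //; apply/eqP. Qed.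

Lemma walk_simple_path T x p : path T x p ->
  exists q, [/\ is_simple_path T x (last x p) q, size q <= size p
              & {subset q <= p}].
Proof.
case/shortenP=> q pq uq sub; exists q; split=> //; first exact/simple_pathP.
by apply: uniq_leq_size sub; case/andP: uq.
Qed.

Lemma rev_walk T x p : symmetric T -> path T x p ->
  path T (last x p) (rev (belast x p)).
Proof.
move=> sT; rewrite rev_path; apply: sub_path => a b /=; by rewrite sT.
Qed.

Lemma cons_rev_belast x p : last x p :: rev (belast x p) = rev (x :: p).
Proof. by rewrite [x :: p in RHS]lastI rev_rcons. Qed.

Lemma last_rev_belast x p : last (last x p) (rev (belast x p)) = x.
Proof.
by case: p => [|a p] //=; rewrite rev_cons last_rcons.
Qed.

Lemma rev_simple_path T x y p : symmetric T -> is_simple_path T x y p ->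
  is_simple_path T y x (rev (belast x p)).
Proof.
move=> sT /simple_pathP[xp <- up]; apply/simple_pathP; split.
- exact: rev_walk.
- exact: last_rev_belast.
- by rewrite cons_rev_belast rev_uniq.
Qed.

(** Where two paths first diverge, at [x] with next vertices [a] and [b], their remainders form a
    walk from [a] to [b] avoiding [x]. Shortened and closed through [x], it is a cycle of length at
    least 3. *)
Lemma simple_path_unique T x y p q : symmetric T -> acyclic T ->
  is_simple_path T x y p -> is_simple_path T x y q -> p = q.
Proof.
move=> sT aT; elim: p x q => [|a p IH] x [|b q] //.
- move=> /simple_pathP[_ /= <- _] /simple_pathP[_ /= qx /andP[xq _]].
  by case/negP: xq; rewrite -[in X in X \in _]qx mem_last.
- move=> /simple_pathP[_ /= px /andP[xp _]] /simple_pathP[_ /= xy _].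
  by case/negP: xp; rewrite {1}xy -px mem_last.
move=> sp sq; have /simple_pathP[] := sp => /= /andP[xa ap] lp /andP[xap uap].
have /simple_pathP[] := sq => /= /andP[xb bq] lq /andP[xbq ubq].
have [eab|ab] := eqVneq a b.
  congr cons => //; apply: (IH a).
    by apply/simple_pathP.
  by apply/simple_pathP; split; rewrite // eab.
have /walk_simple_path[s [/simple_pathP[as_ ls us] _ sub]] :
    path T a (p ++ rev (belast b q)).
  by rewrite cat_path ap lp -lq rev_walk.
rewrite last_cat lp -lq last_rev_belast in ls.
have /aT : ucycle T (x :: a :: s).
  rewrite /ucycle /= rcons_path xa as_ ls sT xb /= -/(uniq (a :: s)) us andbT.
  rewrite inE negb_or; apply/andP; split.
    by apply: contraNneq xap => ->; rewrite mem_head.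
  apply/negP => /sub; rewrite mem_cat mem_rev => /orP[xp|/mem_belast xq].
    by rewrite inE xp orbT in xap.
  by rewrite xq in xbq.
by case: s ls {as_ us sub} => //= eab; rewrite eab eqxx in ab.
Qed.

Lemma tree_path_simple T x y p : symmetric T -> acyclic T ->
  is_simple_path T x y p -> tree_path T x y = p.
Proof.
move=> sT aT sp; rewrite /tree_path; case: pickP => [q sq|none].
  exact: simple_path_unique sq sp.
have /simple_pathP[_ _ /= /andP[_ up]] := sp.
have szp : size p <= #|V|.
  by rewrite cardT; apply: uniq_leq_size => // z _; rewrite mem_enum.
by have := none (Bseq szp); rewrite /= sp.
Qed.

Lemma hop_simple T x y p : symmetric T -> acyclic T ->
  is_simple_path T x y p -> hop T x y = size p.
Proof. by move=> sT aT sp; rewrite /hop (tree_path_simple sT aT sp). Qed.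

Lemma hop_walk T x p : symmetric T -> acyclic T -> path T x p ->
  hop T x (last x p) <= size p.
Proof.
by move=> sT aT /walk_simple_path[q [sq le _]]; rewrite (hop_simple sT aT sq).
Qed.

Lemma tree_path_spec T x y : is_spanning_tree T ->
  is_simple_path T x y (tree_path T x y).
Proof.
move=> [sT _ cT aT]; have /connectP[p xp ->] := cT x y.
have [q [sq _ _]] := walk_simple_path xp.
by rewrite (tree_path_simple sT aT sq).
Qed.

Lemma hop_gt0 T x y : is_spanning_tree T -> x != y -> 0 < hop T x y.
Proof.
move=> /tree_path_spec-/(_ x y)/simple_pathP[_ lxy _] xy.
by rewrite lt0n size_eq0; apply: contra_neq xy => nil; rewrite -lxy nil.
Qed.

Lemma hop_adj T x y : is_spanning_tree T -> x != y -> hop T x y <= 1 -> T x y.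
Proof.
move=> /tree_path_spec-/(_ x y)/simple_pathP[] + + _ xy; rewrite /hop.
case: tree_path => [|a [|b p]] //= => [_ exy|]; first by rewrite exy eqxx in xy.
by move=> /andP[xa _] <-.
Qed.

End SimplePaths.

(** * Distance matrices of forests, and their update when an edge is added *)

Section ForestMatrix.

Variable V : finType.
Implicit Types (E : V -> V -> nat) (x y z u v : V) (p q : seq V).

Definition adj E : rel V := fun x y => E x y == 2.

(* E x y is one plus the number of edges of the path from x to y of the forest
   [adj E], and 0 when there is no such path. *)
Record forest_mx E : Prop := ForestMx {
  fmx_sym : forall x y, E x y = E y x;
  fmx_acyclic : acyclic (adj E);
  fmx_path : forall x y, E x y != 0 ->
    exists2 p, is_simple_path (adj E) x y p & E x y = (size p).+1;
  fmx_walk : forall x p, path (adj E) x p -> E x (last x p) != 0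
}.

(** A nonzero entry is the number of vertices of a path. The path from [x] to [y] through the new
    edge consists of two disjoint paths, so the entries add up without correction. *)
Definition link E u v x y : nat :=
  if (E x u != 0) && (E y v != 0) then E x u + E y v
  else if (E y u != 0) && (E x v != 0) then E y u + E x v
  else E x y.

Section Theory.

Variable E : V -> V -> nat.
Hypothesis fE : forest_mx E.

Lemma adj_sym : symmetric (adj E).
Proof. by move=> x y; rewrite /adj fmx_sym. Qed.

Lemma fmx_simple x y p : is_simple_path (adj E) x y p -> E x y = (size p).+1.
Proof.
move=> sp; have /simple_pathP[xp lp _] := sp.
have nz : E x y != 0 by rewrite -lp fmx_walk.
have [q sq ->] := fmx_path fE nz.
by rewrite (simple_path_unique adj_sym (fmx_acyclic fE) sp sq).
Qed.

Lemma fmx_diag x : E x x = 1.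
Proof. by apply: (@fmx_simple x x [::]); apply/simple_pathP. Qed.

Lemma fmx_eq1 x y : E x y = 1 -> x = y.
Proof.
move=> e1; have [|p /simple_pathP[_ lp _]] := fmx_path fE (x := x) (y := y).
  by rewrite e1.
by rewrite e1 => -[/esym/eqP/nilP p0]; rewrite -lp p0.
Qed.

Lemma fmx_walk_le x p : path (adj E) x p -> E x (last x p) <= (size p).+1.
Proof. by case/walk_simple_path=> q [sq le _]; rewrite (fmx_simple sq). Qed.

Lemma fmx_mem x p z : path (adj E) x p -> z \in x :: p -> E x z != 0.
Proof.
rewrite inE => xp /orP[/eqP ->|zp]; first by rewrite fmx_diag.
case/path.splitP: zp xp => p1 p2; rewrite cat_path => /andP[/fmx_walk].
by rewrite last_rcons => /(_ fE).
Qed.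

(** The inequality is strict because the sum counts the vertex [y] twice. *)
Lemma fmx_triangle x y z : E x y != 0 -> E y z != 0 ->
  0 < E x z < E x y + E y z.
Proof.
move=> /(fmx_path fE)[p /simple_pathP[xp lp _] ->].
move=> /(fmx_path fE)[q /simple_pathP[yq lq _] ->].
have w : path (adj E) x (p ++ q) by rewrite cat_path xp lp.
have := fmx_walk fE w; have := fmx_walk_le w.
rewrite last_cat lp lq size_cat; lia.
Qed.

Lemma fmx_trans x y z : E x y != 0 -> E y z != 0 -> E x z != 0.
Proof. by move=> xy /(fmx_triangle xy); rewrite lt0n => /andP[]. Qed.

Lemma adj_irr : irreflexive (adj E).
Proof. by move=> x; rewrite /adj fmx_diag. Qed.

Lemma forest_spanning_tree : (forall x y, E x y != 0) ->
  is_spanning_tree (adj E).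
Proof.
move=> cE; split; [exact: adj_sym | exact: adj_irr | | exact: fmx_acyclic].
move=> x y; have [p /simple_pathP[xp lp _] _] := fmx_path fE (cE x y).
by apply/connectP; exists p.
Qed.

Lemma fmx_hop x y : E x y != 0 -> E x y = (hop (adj E) x y).+1.
Proof.
move=> /(fmx_path fE)[p sp ->].
by rewrite (hop_simple adj_sym (fmx_acyclic fE) sp).
Qed.

Section Link.

Variables u v : V.
Hypothesis uv : E u v = 0.
Local Notation E' := (link E u v).

(** Hence the two tests of [link] never both succeed. *)
Lemma link_sep x : ~~ ((E x u != 0) && (E x v != 0)).
Proof.
apply/negP => /andP[xu xv]; have := @fmx_trans u x v.
by rewrite (fmx_sym fE u) uv => /(_ xu xv).
Qed.

Lemma link_sym x y : E' x y = E' y x.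
Proof.
rewrite /link (fmx_sym fE x y); have := link_sep x; have := link_sep y.
by do 4 case: (_ != 0).
Qed.

Lemma link_id x y : E x y != 0 -> E' x y = E x y.
Proof.
move=> xy; rewrite /link; case: ifP => [/andP[xu yv]|_].
  by case/negP: (link_sep y); rewrite yv andbT (fmx_trans _ xu) // fmx_sym.
case: ifP => [/andP[yu xv]|//].
by case/negP: (link_sep x); rewrite xv andbT (fmx_trans _ yu) // fmx_sym.
Qed.

(** A sum of two nonzero entries is 2 only if both are 1, that is, only for the pair of [u] and
    [v]. *)
Lemma adj_link : adj E' =2
  [rel x y | [|| adj E x y, (x == u) && (y == v) | (x == v) && (y == u)]].
Proof.
move=> x y /=; have [xy|nxy] := boolP (adj E x y).
  by rewrite /adj link_id ?(eqP xy).
have eq1 a b : (E a b == 1) = (a == b).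
  by apply/eqP/eqP => [/fmx_eq1|->]; last exact: fmx_diag.
rewrite /adj /link; have := link_sep x; have := link_sep y.
rewrite -!eq1; move: nxy; rewrite /adj; case: ifP => ?; [|case: ifP => ?]; lia.
Qed.

Lemma link_nz x y : (E' x y != 0) =
  [|| (E x u != 0) && (E y v != 0), (E y u != 0) && (E x v != 0) | E x y != 0].
Proof. by rewrite /link; case: ifP => ?; [|case: ifP => ?]; lia. Qed.

(** A longer cycle through the new edge would, once this edge is removed, connect [u] and [v] by old
    edges. *)
Lemma link_acyclic : acyclic (adj E').
Proof.
move=> c cyc; rewrite leqNgt; apply/negP => sz.
suff : ucycle (adj E) c by move/(fmx_acyclic fE); rewrite leqNgt sz.
have /andP[cy uc] := cyc; rewrite /ucycle uc andbT.
apply: cycle_from_next => // x xc; have nx := next_cycle cy xc.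
apply/negPn/negP => nadj.
(* Rotate the cycle so that it starts with the new edge, from [x] to [y]. *)
have [i c' rot_c] := rot_to xc.
move: cyc sz nadj nx; rewrite -(rot_ucycle i) -(size_rot i) -(next_rot i uc) rot_c.
case: c' rot_c => [|y [|z c']] // rot_c; rewrite /= eqxx /ucycle /=.
rewrite rcons_path => /andP[/and4P[xy yz zc lx] uc'] _ nadj.
rewrite adj_link /= (negbTE nadj) /= => exy.
have xyuv : (x == u) && (y == v) || (x == v) && (y == u) by [].
have old a b : a != x -> b != x -> adj E' a b -> adj E a b.
  rewrite adj_link /= => ax bx /or3P[//||] /andP[/eqP ea /eqP eb].
    by case/orP: xyuv ax bx => /andP[/eqP -> _]; rewrite ea eb eqxx.
  by case/orP: xyuv ax bx => /andP[/eqP -> _]; rewrite ea eb eqxx.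
have /andP[xn yn] : (x \notin y :: z :: c') && (y \notin z :: c').
  by move: uc'; rewrite /= !inE => /and3P[-> ->].
have path_y : path (adj E) y (z :: c').
  apply: (@sub_in_path _ (predC1 x) (adj E')) => /=; last by rewrite yz zc.
    by move=> a b; rewrite !inE; exact: old.
  by move: xn; rewrite !inE !negb_or 2![x == _]eq_sym => /and3P[-> -> nx] /=;
    apply/allP => w wc; rewrite inE /=; apply: contraNneq nx => <-.
(* The closing edge is old too: otherwise its other end would be [y], which does not recur. *)
have lxE : adj E (last z c') x.
  have ly : last z c' != y by apply: contraNneq yn => <-; rewrite mem_last.
  have nuv : v != u by apply/eqP => evu; move: uv; rewrite evu fmx_diag.
  move: lx ly; rewrite adj_link /= => /or3P[//||] /andP[/eqP -> /eqP ex].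
    by case/orP: xyuv nuv => /andP[/eqP xu /eqP ->]; rewrite -ex -?xu eqxx.
  by case/orP: xyuv nuv => /andP[/eqP xu /eqP ->]; rewrite -ex -?xu eqxx.
have := fmx_walk fE (x := y) (p := rcons (z :: c') x).
rewrite rcons_path path_y lxE last_rcons => /(_ isT).
by case/orP: xyuv => /andP[/eqP -> /eqP ->]; rewrite ?uv // (fmx_sym fE v) uv.
Qed.

Lemma link_path x y : E x u != 0 -> E y v != 0 ->
  exists2 p, is_simple_path (adj E') x y p & E' x y = (size p).+1.
Proof.
move=> xu yv; have [p /simple_pathP[xp lp up] sp] := fmx_path fE xu.
have vy : E v y != 0 by rewrite fmx_sym.
have [q /simple_pathP[vq lq uq] sq] := fmx_path fE vy.
have sub : subrel (adj E) (adj E') by move=> a b ab; rewrite adj_link /= ab.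
exists (p ++ v :: q); last first.
  by rewrite /link xu yv /= sp (fmx_sym fE y) sq size_cat /=; lia.
apply/simple_pathP; split.
- rewrite cat_path (sub_path sub xp) lp /= (sub_path sub vq) andbT.
  by rewrite adj_link /= !eqxx orbT.
- by rewrite last_cat /= lq.
- rewrite -cat_cons cat_uniq up uq andbT andTb.
  apply/hasPn => z zq; apply/negP => zp; case/negP: (link_sep z).
  rewrite (fmx_sym fE z v) (fmx_mem vq zq) andbT.
  by apply: fmx_trans xu; rewrite (fmx_sym fE z x); apply: fmx_mem zp.
Qed.

Lemma link_forest : forest_mx E'.
Proof.
split; [exact: link_sym | exact: link_acyclic | |].
- move=> x y; rewrite link_nz => /or3P[/andP[xu yv]|/andP[yu xv]|xy].
  + exact: link_path.
  + have [p sp ep] := link_path yu xv.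
    exists (rev (belast y p)); last by rewrite link_sym ep size_rev size_belast.
    by apply: rev_simple_path sp => a b; rewrite /adj link_sym.
  + have [p /simple_pathP[xp lp up] sp] := fmx_path fE xy.
    exists p; last by rewrite link_id.
    apply/simple_pathP; split=> //; apply: sub_path xp => a b ab.
    by rewrite adj_link /= ab.
- move=> x p; elim/last_ind: p => [|p z IH] /=; first by rewrite link_id fmx_diag.
  rewrite rcons_path last_rcons => /andP[/IH]; move: (last x p) => y.
  have tr a b c : E a b != 0 -> E b c != 0 -> E a c != 0 by apply: fmx_trans.
  rewrite adj_link !link_nz /= => xy.
  case/or3P=> [yz|/andP[/eqP yu /eqP zv]|/andP[/eqP yv /eqP zu]].
  + have zy : E z y != 0 by rewrite fmx_sym // (eqP yz).
    have yz' : E y z != 0 by rewrite (eqP yz).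
    case/or3P: xy => [/andP[-> yv]|/andP[yu ->]|xy].
    * by rewrite (tr _ _ _ zy yv).
    * by rewrite (tr _ _ _ zy yu) orbT.
    * by rewrite (tr _ _ _ xy yz') !orbT.
  + move: xy; rewrite yu zv uv !fmx_diag /=.
    by case: (E x u != 0); case: (E x v != 0); rewrite ?orbT.
  + move: xy; rewrite yv zu !fmx_diag /= (fmx_sym fE v u) uv /=.
    by case: (E x u != 0); case: (E x v != 0); rewrite ?orbT.
Qed.

End Link.

End Theory.

(** The step of Kruskal's algorithm: an edge that would close a cycle is skipped. *)
Definition join E u v : V -> V -> nat :=
  if E u v != 0 then E else link E u v.

Section Join.

Variables (E : V -> V -> nat) (u v : V).
Hypothesis fE : forest_mx E.

Lemma join_forest : forest_mx (join E u v).
Proof.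
rewrite /join; have [//|/negPn/eqP uv] := boolP (E u v != 0); exact: link_forest.
Qed.

Lemma join_id x y : E x y != 0 -> join E u v x y = E x y.
Proof.
rewrite /join; have [//|/negPn/eqP uv] := boolP (E u v != 0); exact: link_id.
Qed.

Lemma join_conn : join E u v u v != 0.
Proof.
rewrite /join; have [//|/negPn/eqP uv] := boolP (E u v != 0).
by rewrite (link_nz uv) !(fmx_diag fE).
Qed.

Lemma join_adj x y : adj (join E u v) x y ->
  [|| adj E x y, (x == u) && (y == v) | (x == v) && (y == u)].
Proof.
rewrite /join; have [_ -> //|/negPn/eqP uv] := boolP (E u v != 0).
by rewrite adj_link.
Qed.

End Join.

Lemma discrete_forest_mx : forest_mx (fun x y : V => (x == y) : nat).
Proof.
have noadj x y : adj (fun x y : V => (x == y) : nat) x y = false.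
  by rewrite /adj; case: (x == y).
split.
- by move=> x y; rewrite eq_sym.
- case=> [|x c] //; rewrite /ucycle => /andP[/next_cycle/(_ (mem_head x c))].
  by rewrite noadj.
- move=> x y; have [-> _|//] := eqVneq x y.
  by exists [::] => //; exact/simple_pathP.
- by move=> x [|y p] /=; rewrite ?eqxx // noadj.
Qed.

End ForestMatrix.

(** * Joining components at their centers *)

Section HubTree.

(** Like the entries of [E], the values of [ecc] and [rad] are one plus an eccentricity and one plus
    the radius of a component; [T] is a competing tree that contains the forest. *)
Variables (V : finType) (E : V -> V -> nat) (T : rel V) (ecc rad : V -> nat).
Implicit Types (x y z u v : V) (p q : seq V).

Hypothesis fE : forest_mx E.
Hypothesis treeT : is_spanning_tree T.
Hypothesis adjET : subrel (adj E) T.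
Hypothesis ecc_ub : forall x y, E x y <= ecc x.
Hypothesis ecc_attained : forall x, exists y, E x y = ecc x.
Hypothesis rad_lb : forall x y, E x y != 0 -> rad x <= ecc y.
Hypothesis rad_attained : forall x, exists2 c, E x c != 0 & ecc c = rad x.

Lemma forest_path x y : E x y != 0 -> exists p,
  [/\ is_simple_path T x y p, E x y = (size p).+1
    & forall z, z \in x :: p -> E x z != 0].
Proof.
move=> /(fmx_path fE)[p /simple_pathP[xp lp up] ep]; exists p; split=> //.
  by apply/simple_pathP; split=> //; apply: sub_path xp.
by move=> z; apply: fmx_mem.
Qed.

Lemma fmx_hop_super x y : E x y != 0 -> E x y = (hop T x y).+1.
Proof.
have [sT _ _ aT] := treeT.
by move=> /forest_path[p [sp -> _]]; rewrite (hop_simple sT aT sp).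
Qed.

Lemma rad_component x y : E x y != 0 -> rad x = rad y.
Proof.
suff le a b : E a b != 0 -> rad a <= rad b.
  by move=> xy; apply/eqP; rewrite eqn_leq !le // fmx_sym.
move=> ab; have [c bc <-] := rad_attained b; apply: rad_lb.
exact: fmx_trans bc.
Qed.

(* Join a closest pair (u, w) of the two components by the tree path, and
   prolong it at each end to a farthest vertex of the component. *)
Lemma hop_two_components a b : E a b = 0 -> exists u w x y,
  [/\ E a u != 0, E b w != 0 & rad a + rad b + hop T u w <= hop T x y + 2].
Proof.
move=> ab; have [sT _ _ aT] := treeT.
pose P (uw : V * V) := (E a uw.1 != 0) && (E b uw.2 != 0).
have P0 : P (a, b) by rewrite /P /= !fmx_diag.
case: (arg_minnP (fun uw : V * V => hop T uw.1 uw.2) P0) => -[u w] /andP[/= au bw].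
move=> min; have sp := tree_path_spec u w treeT.
have /simple_pathP[up lp] := sp.
move: (hop_simple sT aT sp) up lp; move: (tree_path T u w) => p {sp} hp up lp unp.
have sep z : E a z != 0 -> E b z != 0 -> False.
  rewrite (fmx_sym fE b) => az /(fmx_trans fE az); by rewrite ab.
have split_p z : z \in p -> exists p1 p2,
    [/\ p = rcons p1 z ++ p2, hop T u z <= (size p1).+1 & hop T z w <= size p2].
  move=> zp; case/path.splitP: zp up lp => p1 p2.
  rewrite cat_path last_cat last_rcons => /andP[up1 zp2] lp2.
  exists p1, p2; split=> //; last by rewrite -lp2 hop_walk.
  by rewrite -(size_rcons p1 z) -{1}(last_rcons u p1 z) hop_walk.
(* A vertex after [u] in the component of [a] would give a closer pair, and so would, below, a
   vertex before [w] in the component of [b]. *)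
have pa z : z \in p -> E a z = 0.
  move=> zp; apply/eqP/negPn/negP => az.
  have [p1 [p2 [ep _ le]]] := split_p _ zp.
  have := min (z, w); rewrite /P /= az bw => /(_ isT).
  rewrite hp ep size_cat size_rcons; lia.
have pb z : z \in p -> E b z != 0 -> z = w.
  move=> zp bz; have [p1 [p2 [ep le _]]] := split_p _ zp.
  have := min (u, z); rewrite /P /= au bz => /(_ isT).
  rewrite hp ep size_cat size_rcons => le2.
  have p20 : p2 = [::] by apply/nilP; rewrite /nilp; lia.
  by rewrite -lp ep p20 cats0 last_rcons.
have [x ex] := ecc_attained u; have [y ey] := ecc_attained w.
have rx := rad_lb au; have ry := rad_lb bw.
have e0 z : 0 < ecc z by apply: leq_trans (ecc_ub z z); rewrite fmx_diag.
have ux : E u x != 0 by rewrite ex -lt0n.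
have wy : E w y != 0 by rewrite ey -lt0n.
have xu : E x u != 0 by rewrite fmx_sym.
have [q [/simple_pathP[xq lq uq] sq mq]] := forest_path xu.
have [r [/simple_pathP[wr lr ur] sr mr]] := forest_path wy.
(* [q] and [r] stay in the components of [a] and [b], which [p] meets only in its last vertex
   [w]. *)
have s : is_simple_path T x y (q ++ p ++ r).
  apply/simple_pathP; split.
  - by rewrite !cat_path xq lq up lp wr.
  - by rewrite !last_cat lq lp.
  have qa z : z \in x :: q -> E a z != 0.
    by move=> /mq; apply: fmx_trans => //; apply: fmx_trans ux.
  have rb z : z \in w :: r -> E b z != 0.
    by move=> /mr; apply: fmx_trans.
  rewrite !cons_uniq in unp ur; case/andP: unp ur => _ unp /andP[wr' ur].
  rewrite -cat_cons cat_uniq uq cat_uniq unp ur andbT !andTb.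
  apply/andP; split; last first.
    apply/hasPn => z zr; apply/negP => zp.
    have zb : E b z != 0 by apply: rb; rewrite inE zr orbT.
    by case/negP: wr'; rewrite -(pb z).
  apply/hasPn => z zpr; apply/negP => /qa az.
  move: zpr; rewrite mem_cat => /orP[/pa az0|zr]; first by rewrite az0 in az.
  by apply: (sep z az); apply: rb; rewrite inE zr orbT.
exists u, w, x, y; split=> //.
rewrite (hop_simple sT aT s) hp !size_cat.
move: sq sr; rewrite (fmx_sym fE x) ex ey; lia.
Qed.

(* Three components pairwise joined by an edge of T would close a cycle. *)
Lemma hop_three_components a b c :
  E a b = 0 -> E b c = 0 -> E a c = 0 ->
  exists x y, [\/ rad a + rad b <= hop T x y, rad b + rad c <= hop T x y
                | rad a + rad c <= hop T x y].
Proof.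
move=> ab bc ac; have [sT _ _ aT] := treeT.
have sep a1 b1 x y : E a1 b1 = 0 -> E a1 x != 0 -> E b1 y != 0 -> x != y.
  move=> e ax; rewrite (fmx_sym fE b1) => yb; apply/eqP => xy.
  by have := fmx_trans fE ax; rewrite xy => /(_ _ yb); rewrite e.
have [u1 [w1 [x1 [y1 [au1 bw1 h1]]]]] := hop_two_components ab.
have [u2 [w2 [x2 [y2 [bu2 cw2 h2]]]]] := hop_two_components bc.
have [u3 [w3 [x3 [y3 [au3 cw3 h3]]]]] := hop_two_components ac.
(* A connection of length at least 2 already gives the bound; otherwise all three are edges of
   [T]. *)
case: (leqP (hop T u1 w1) 1) => [/hop_adj|] t1; last first.
  by exists x1, y1; apply: Or31; lia.
case: (leqP (hop T u2 w2) 1) => [/hop_adj|] t2; last first.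
  by exists x2, y2; apply: Or32; lia.
case: (leqP (hop T u3 w3) 1) => [/hop_adj|] t3; last first.
  by exists x3, y3; apply: Or33; lia.
have {}t1 := t1 treeT (sep _ _ _ _ ab au1 bw1).
have {}t2 := t2 treeT (sep _ _ _ _ bc bu2 cw2).
have {}t3 := t3 treeT (sep _ _ _ _ ac au3 cw3).
have inner d s t : E d s != 0 -> E d t != 0 ->
    exists p, is_simple_path T s t p /\ forall z, z \in s :: p -> E d z != 0.
  move=> ds dt; have st : E s t != 0 by apply: fmx_trans dt; rewrite // fmx_sym.
  have [p [sp _ mp]] := forest_path st; exists p; split=> // z /mp.
  exact: fmx_trans.
have [p [/simple_pathP[pw lp up] mp]] := inner _ _ _ au3 au1.
have [q [/simple_pathP[qw lq uq] mq]] := inner _ _ _ bw1 bu2.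
have [r [/simple_pathP[rw lr ur] mr]] := inner _ _ _ cw2 cw3.
have /aT : ucycle T ((u3 :: p) ++ (w1 :: q) ++ (w2 :: r)); last first.
  by rewrite !size_cat /=; lia.
rewrite /ucycle; apply/andP; split.
  rewrite /= rcons_path !cat_path !last_cat /= lp t1 pw cat_path qw lq /= t2 rw.
  by rewrite last_cat /= lr sT t3.
rewrite cat_uniq up cat_uniq uq ur !andTb andbT.
apply/andP; split; apply/hasPn => z.
  rewrite mem_cat => /orP[/mq bz|/mr cz]; apply/negP => /mp az.
    by have := sep _ _ _ _ ab az bz; rewrite eqxx.
  by have := sep _ _ _ _ ac az cz; rewrite eqxx.
by move=> /mr cz; apply/negP => /mq bz; have := sep _ _ _ _ bc bz cz; rewrite eqxx.
Qed.

Variables (E' : V -> V -> nat) (h : V).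
Hypothesis fE' : forest_mx E'.
Hypothesis connE' : forall x y, E' x y != 0.
Hypothesis extE' : forall x y, E x y != 0 -> E' x y = E x y.
Hypothesis hub_central : ecc h = rad h.
Hypothesis hub_max : forall x, ecc x = rad x -> rad x <= rad h.
(** The center joined to the hub need not be [x] itself, since a component may have two centers. *)
Hypothesis attached : forall x, ecc x = rad x ->
  exists2 c, E x c != 0 /\ ecc c = rad c & E h c != 0 \/ adj E' h c.

Lemma component_center x : exists c,
  [/\ E x c != 0, E x c <= rad x & E h c != 0 \/ adj E' h c].
Proof.
have [d xd ed] := rad_attained x.
have [|c [dc ec] hc] := attached (x := d); first by rewrite ed (rad_component xd).
have xc := fmx_trans fE xd dc; exists c; split=> //.
by rewrite (rad_component xc) -ec fmx_sym.
Qed.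

Lemma rad_le_hub x : rad x <= rad h.
Proof.
have [d xd ed] := rad_attained x.
have := hub_max (x := d); rewrite ed -(rad_component xd); exact.
Qed.

(** From [x] go to the center joined to the hub, then along one more edge; in the component of the
    hub, itself a center, the extra edge is absent. *)
Lemma hub_tree_dist x : exists2 k, E' x h <= rad x + k & k = (E h x == 0).
Proof.
exists (E h x == 0) => //; case: eqP => [hx|/eqP hx]; last first.
  rewrite addn0 -(rad_component hx) -hub_central fmx_sym // extE' //.
have [c [xc le [hc|hc]]] := component_center x.
  by rewrite (fmx_sym fE) in xc; have := fmx_trans fE hc xc; rewrite hx.
have := fmx_triangle fE' (connE' x c) (connE' c h).
rewrite (extE' xc) (fmx_sym fE' c) (eqP hc); lia.
Qed.

(** Within one component the distance is the same in [T]. If one of the two vertices lies with the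
    hub, the bound for two components applies with a connection of length at least 1. Otherwise the
    bound for three components applies, and any pair of them will do because the hub has the largest
    radius. *)
Lemma hub_tree_diameter x y : exists x' y', E' x y <= (hop T x' y').+1.
Proof.
have [xy|/negPn/eqP xy] := boolP (E x y != 0).
  by exists x, y; rewrite extE' // fmx_hop_super.
have [i lx ei] := hub_tree_dist x; have [j ly ej] := hub_tree_dist y.
have := fmx_triangle fE' (connE' x h) (connE' h y); rewrite (fmx_sym fE' h y) => tri.
have gt0 a b : E a b = 0 -> forall u w, E a u != 0 -> E b w != 0 -> 0 < hop T u w.
  move=> ab u w au; rewrite (fmx_sym fE b) => wb; apply: hop_gt0 treeT _.
  by apply: contraTneq wb => <-; apply/negP => /(fmx_trans fE au); rewrite ab.
case: eqP ei => [hx ei|/eqP hx ei].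
  case: eqP ej => [hy ej|/eqP hy ej].
    have [x' [y' le]] := hop_three_components hx xy hy; exists x', y'.
    by have := rad_le_hub x; have := rad_le_hub y; case: le; lia.
  have [u [w [x' [y' [hu xw le]]]]] := hop_two_components hx; exists x', y'.
  have := gt0 _ _ hx _ _ hu xw; have := rad_component hy; lia.
case: eqP ej => [hy ej|/eqP hy ej].
  have [u [w [x' [y' [hu yw le]]]]] := hop_two_components hy; exists x', y'.
  have := gt0 _ _ hy _ _ hu yw; have := rad_component hx; lia.
have xh : E x h != 0 by rewrite fmx_sym.
by have := fmx_trans fE xh hy; rewrite xy.
Qed.

End HubTree.

(** * Attaching the centers to the hub one after the other *)

Section Attach.

Variables (V : finType) (E : V -> V -> nat) (ecc rad : V -> nat) (h : V).
Hypothesis fE : forest_mx E.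
Hypothesis rad_attained : forall x, exists2 c, E x c != 0 & ecc c = rad x.
Hypothesis rad_lb : forall x y, E x y != 0 -> rad x <= ecc y.

(** Invariant of the attaching loop. By [attaching_hub], a component not yet attached is still a
    component of the initial forest. *)
Record attaching (E' : V -> V -> nat) : Prop := Attaching {
  attaching_forest : forest_mx E';
  attaching_ext : forall x y, E x y != 0 -> E' x y = E x y;
  attaching_center : forall x, E' h x != 0 ->
    exists2 c, E x c != 0 /\ ecc c = rad c & E h c != 0 \/ adj E' h c;
  attaching_hub : forall x y, E' x y != 0 -> E x y != 0 \/ E' h x != 0
}.

Lemma attaching_start : ecc h = rad h -> attaching E.
Proof.
move=> eh; split=> // [x hx|x y xy]; last by left.
by exists h; [rewrite (fmx_sym fE) | left; rewrite fmx_diag].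
Qed.

Lemma attaching_join E' v : attaching E' -> ecc v = rad v ->
  attaching (join E' h v).
Proof.
move=> aE' ev; have [fE' ext center hub] := aE'.
rewrite /join; have [//|/negPn/eqP hv] := boolP (E' h v != 0).
split; first exact: link_forest.
- by move=> x y xy; rewrite link_id // ext.
- move=> x; rewrite link_nz // !(fmx_diag fE') hv andbF /= => /orP[xv|hx].
    (* The component of [v] is not attached yet, so it is an original one, and [v] is the center
       sought. *)
    have [xv'|] := hub x v xv; last first.
      by move=> hx; have := fmx_trans fE' hx xv; rewrite hv.
    by exists v => //; right; rewrite adj_link //= !eqxx orbT.
  have [c xc [hc|hc]] := center x hx; exists c => //; first by left.
  by right; rewrite adj_link //= hc.
- move=> x y; rewrite !link_nz // (fmx_diag fE') /=.
  case/or3P=> [/andP[xh _]|/andP[_ xv]|/hub[xy|hx]].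
  + by right; rewrite (fmx_sym fE' h x) xh !orbT.
  + by right; rewrite xv.
  + by left.
  + by right; rewrite hx !orbT.
Qed.

Lemma attaching_connected E' : attaching E' ->
  (forall x, ecc x = rad x -> E' h x != 0) -> forall x y, E' x y != 0.
Proof.
move=> [fE' ext _ _] all_h.
have conn x : E' h x != 0.
  have [c xc ec] := rad_attained x.
  have cx : E c x != 0 by rewrite (fmx_sym fE).
  (* The vertex attaining the radius for [x] is a center for its own radius, the radius being
     constant on a component. *)
  have rc : ecc c = rad c.
    rewrite ec; have [d cd ed] := rad_attained c; apply/eqP; rewrite eqn_leq.
    rewrite -{2}ec rad_lb ?fmx_diag // andbT -ed rad_lb //.
    exact: (fmx_trans fE) xc cd.
  apply: (fmx_trans fE') (all_h _ rc) _; by rewrite ext.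
by move=> x y; apply: (fmx_trans fE') (conn y); rewrite (fmx_sym fE').
Qed.

End Attach.

(** * Costs *)

Section Cost.

Variable V : finType.
Variables d r : V -> V -> rat.
Implicit Types T : rel V.

Lemma hopxx T x : is_spanning_tree T -> hop T x x = 0.
Proof.
by move=> [sT _ _ aT]; apply: (hop_simple sT aT (p := [::])); apply/simple_pathP.
Qed.

Hypothesis d_ge0 : forall x y, (0 <= d x y)%R.
Hypothesis d_uniform : exists c, forall x y, x != y -> d x y = c.
Hypothesis r_ge0 : forall x y, (0 <= r x y)%R.

Lemma tree_dist_uniform T c x y : is_spanning_tree T ->
  (forall x y, x != y -> d x y = c) ->
  tree_dist d T x y = (c * (hop T x y)%:R)%R.
Proof.
move=> treeT dc; rewrite /tree_dist /hop.
have /simple_pathP[_ _] := tree_path_spec x y treeT.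
move: (tree_path T x y) => p; elim: p x => [|a p IH] x /=.
  by rewrite big_nil mulr0.
rewrite inE negb_or => /andP[/andP[xa _] u]; rewrite big_cons IH // dc //.
by rewrite -natr1 mulrDr mulr1 addrC.
Qed.

Lemma diameter_cost_le T T' : is_spanning_tree T -> is_spanning_tree T' ->
  (forall x y, x != y -> exists x' y', x' != y' /\
     (r x y * (hop T x y)%:R <= r x' y' * (hop T' x' y')%:R)%R) ->
  (diameter_cost d r T <= diameter_cost d r T')%R.
Proof.
move=> treeT treeT' dom; have [c dc] := d_uniform; rewrite /diameter_cost.
apply: bigmax_le => [|[x y] /= xy]; first exact: bigmax_ge_id.
(* The sign of [c] is known only through a pair of distinct nodes. *)
have c0 : (0 <= c)%R by rewrite -(dc _ _ xy).
have [x' [y' [xy' le]]] := dom _ _ xy.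
apply: le_trans (le_bigmax_cond _ _ (j := (x', y')) _); last by [].
rewrite /= !(tree_dist_uniform _ _ _ dc) // !(mulrCA _ c).
exact: ler_wpM2l.
Qed.

Hypothesis two_values :
  exists a b, forall x y, x != y -> r x y = a \/ r x y = b.

Variable b : rat.
Hypothesis r_le_b : forall x y, x != y -> (r x y <= b)%R.
Hypothesis b_attained : b = 0%R \/ exists x y, x != y /\ b = r x y.

(** With two values at most, one below the largest is the least. The case [b = 0] leaves no room
    below [b]. *)
Lemma low_requirement x y u v : x != y -> u != v ->
  (r x y < b)%R -> (r x y <= r u v)%R.
Proof.
move=> xy uv lt; case: b_attained => [b0|[s [t [st bst]]]].
  by move: lt; rewrite b0 ltNge r_ge0.
have [a [b' two]] := two_values.
have := ltW lt; move: lt; rewrite bst.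
by case: (two _ _ xy) (two _ _ uv) (two _ _ st) => -> [] -> [] ->;
  rewrite ?ltxx ?lexx.
Qed.

Variables (E : V -> V -> nat) (S : rel V).
Hypothesis fE : forest_mx E.
Hypothesis connE : forall x y, E x y != 0.
Hypothesis treeS : is_spanning_tree S.
Hypothesis hopS : forall x y, hop S x y <= 2.
(** This hypothesis and the next presuppose a spanning tree containing all pairs of largest
    requirement, as these pairs may form cycles. *)
Hypothesis adjE_high : forall T, is_spanning_tree T ->
  (forall x y, x != y -> (b <= r x y)%R -> T x y) ->
  forall x y, x != y -> (b <= r x y)%R -> adj E x y.
Hypothesis diamE : forall T, is_spanning_tree T ->
  (forall x y, x != y -> (b <= r x y)%R -> T x y) ->
  forall x y, exists x' y', E x y <= (hop T x' y').+1.

Lemma b_ge0 : (0 <= b)%R.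
Proof. by case: b_attained => [->|[x [y [_ ->]]]]. Qed.

Lemma missing_high_edge T : is_spanning_tree T ->
  (exists x y, [/\ x != y, (b <= r x y)%R & ~~ T x y]) \/
  (forall x y, x != y -> (b <= r x y)%R -> T x y).
Proof.
move=> treeT.
have [/existsP[x /existsP[y /and3P[xy bxy nT]]]|no] :=
  boolP [exists x, exists y, [&& x != y, (b <= r x y)%R & ~~ T x y]].
  by left; exists x, y.
right=> x y xy bxy; apply/negPn/negP => nT; case/negP: no.
by apply/existsP; exists x; apply/existsP; exists y; apply/and3P.
Qed.

(** A pair of largest requirement is an edge of the hub tree, so [T] cannot do better on it. Any
    other pair has the least requirement, and is compared with a pair at least as distant in [T]. *)
Lemma hub_tree_dominated T : is_spanning_tree T ->
  (forall x y, x != y -> (b <= r x y)%R -> T x y) ->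
  forall x y, x != y -> exists x' y', x' != y' /\
     (r x y * (hop (adj E) x y)%:R <= r x' y' * (hop T x' y')%:R)%R.
Proof.
move=> treeT highT x y xy; have tE := forest_spanning_tree fE connE.
have [high|low] := leP b (r x y).
  exists x, y; split=> //; apply: ler_wpM2l => //; rewrite ler_nat.
  have := fmx_hop fE (connE x y); rewrite (eqP (adjE_high treeT highT xy high)).
  by move=> [<-]; exact: hop_gt0.
have [x' [y' le]] := diamE treeT highT x y.
rewrite (fmx_hop fE (connE x y)) ltnS in le.
have xy' : x' != y'.
  apply: contraTneq le => ->; rewrite hopxx // -ltnNge; exact: hop_gt0.
exists x', y'; split=> //; apply: ler_pM; rewrite ?ler_nat ?ler0n //.
exact: low_requirement.
Qed.

(** The ends of the missing edge are at distance at least 2 in [T], at a cost of at least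
    [2 * b]. *)
Lemma missing_edge_dominates T U : is_spanning_tree T ->
  (exists x y, [/\ x != y, (b <= r x y)%R & ~~ T x y]) ->
  (forall x y, x != y -> r x y * (hop U x y)%:R <= 2%:R * b)%R ->
  forall x y, x != y -> exists x' y', x' != y' /\
     (r x y * (hop U x y)%:R <= r x' y' * (hop T x' y')%:R)%R.
Proof.
move=> treeT [x' [y' [xy' high nT]]] leU x y xy; exists x', y'; split=> //.
apply: le_trans (leU _ _ xy) _; rewrite mulrC; apply: ler_pM => //.
  exact: b_ge0.
rewrite ler_nat ltnNge; apply: contra nT; exact: hop_adj.
Qed.

Lemma hub_tree_min :
  (forall x y, x != y -> r x y * (E x y).-1%:R <= 2%:R * b)%R ->
  is_min_diameter_cost_spanning_tree d r (adj E).
Proof.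
move=> test; have tE := forest_spanning_tree fE connE; split=> // T treeT.
apply: diameter_cost_le => //; case: (missing_high_edge treeT) => [miss|high].
  apply: missing_edge_dominates => // x y xy.
  by have := test _ _ xy; rewrite (fmx_hop fE (connE x y)).
exact: hub_tree_dominated.
Qed.

Lemma star_min :
  (exists x y, x != y /\ 2%:R * b < r x y * (E x y).-1%:R)%R ->
  is_min_diameter_cost_spanning_tree d r S.
Proof.
move=> [x [y [xy test]]]; split=> // T treeT.
have le2b u v : u != v -> (r u v * (hop S u v)%:R <= 2%:R * b)%R.
  move=> uv; rewrite mulrC; apply: ler_pM; rewrite ?ler0n ?r_le_b //.
  by rewrite ler_nat hopS.
apply: diameter_cost_le => //; case: (missing_high_edge treeT) => [miss|high].
  exact: missing_edge_dominates.
(* The pair on which the hub tree exceeds [2 * b] is dominated by a pair of [T], which therefore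
   costs more than any pair of the star. *)
move=> u v uv; have [x' [y' [xy' le]]] := hub_tree_dominated treeT high xy.
exists x', y'; split=> //; apply: le_trans (le2b _ _ uv) _.
by apply: le_trans (ltW test) _; rewrite (fmx_hop fE (connE x y)).
Qed.

End Cost.

(** * The star centered at node 0 *)

Section Star.

Variable n : nat.

Definition star : rel 'I_n := fun i j => (i == 0 :> nat) != (j == 0 :> nat).

Lemma star_walk (x y : 'I_n) :
  exists p, [/\ path star x p, last x p = y & size p <= 2].
Proof.
have [xy|xy] := boolP (star x y); first by exists [:: y]; rewrite /= xy.
have [exy|nxy] := eqVneq x y; first by exists [::].
have n0 : 0 < n by apply: leq_ltn_trans (ltn_ord x).
exists [:: Ordinal n0; y]; split=> //=.
move: xy nxy; rewrite /star /= -val_eqE /= andbT negbK => /eqP.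
have [->|x0] := eqVneq (val x) 0 => e; rewrite ?eqxx in e.
  by case: eqVneq e => // ->; rewrite eqxx.
by rewrite eqxx -e.
Qed.

Lemma star_spanning_tree : is_spanning_tree star.
Proof.
split.
- by move=> x y; rewrite /star eq_sym.
- by move=> x; rewrite /star eqxx.
- by move=> x y; have [p [xp <- _]] := star_walk x y; apply/connectP; exists p.
(* Along a cycle node 0 alternates with other nodes: with three vertices or more, either it recurs
   or two other nodes are adjacent. *)
move=> c; rewrite leqNgt => /andP[cy uc]; apply/negP => sz.
case: c sz cy uc => [|x [|y [|z c]]] // _; rewrite /= rcons_path /=.
move=> /and4P[xy yz zc lx] /and4P[xn yn zn uc].
have eq0 (a b : 'I_n) : a = 0 :> nat -> b = 0 :> nat -> a = b.
  by move=> a0 b0; apply: val_inj; rewrite /= a0 b0.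
move: xy yz; rewrite /star.
have [x0|x0] := eqVneq (x : nat) 0; have [y0|y0] := eqVneq (y : nat) 0 => //= _.
  have [z0 _|//] := eqVneq (z : nat) 0.
  by case/negP: xn; rewrite (eq0 _ _ x0 z0) !inE eqxx orbT.
have [//|z0 _] := eqVneq (z : nat) 0.
case: c zc lx xn yn zn uc => [|w c] /=.
  by rewrite /star (negbTE z0) (negbTE x0).
move=> /andP[zw _] _ _ yn _ _; case/negP: yn.
have w0 : w = 0 :> nat.
  by apply/eqP; move: zw; rewrite /star (negbTE z0); case: (_ == 0).
by rewrite (eq0 _ _ y0 w0) !inE eqxx !orbT.
Qed.

Lemma star_hop x y : hop star x y <= 2.
Proof.
have [sS _ _ aS] := star_spanning_tree; have [p [xp <- le]] := star_walk x y.
exact: leq_trans (hop_walk sS aS xp) le.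
Qed.

End Star.

(** * Loop programs run in polynomial time *)

(* [CFor k c] runs [c] for each node, whose index is in cell 0 of array [k]; the
   number of nodes is in cell 1 of the input array. *)
Inductive cmd : Type :=
| CSkip
| CWrite (a : nat) (e1 e2 : expr)
| CSeq (c1 c2 : cmd)
| CIf (e : expr) (c1 c2 : cmd)
| CFor (k : nat) (c : cmd).

Definition var (a : nat) : expr := Read a (Const 0).

Definition nodes : expr := Read 0 (Const 1).

Definition incr (k : nat) : expr := Bin Add (var k) (Const 1).

(** The truncated difference in the test of the loop is nonzero exactly while the counter is below
    the number of nodes. *)
Fixpoint compile (c : cmd) : program :=
  match c with
  | CSkip => Skip
  | CWrite a e1 e2 => Write a e1 e2
  | CSeq c1 c2 => Seq (compile c1) (compile c2)
  | CIf e c1 c2 => If e (compile c1) (compile c2)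
  | CFor k c =>
      Seq (Write k (Const 0) (Const 0))
          (While (Bin Defs.Sub nodes (var k))
                 (Seq (compile c) (Write k (Const 0) (incr k))))
  end.

Fixpoint run (c : cmd) (m : memory) : memory :=
  match c with
  | CSkip => m
  | CWrite a e1 e2 => store m a (eval m e1) (eval m e2)
  | CSeq c1 c2 => run c2 (run c1 m)
  | CIf e c1 c2 => if eval m e != 0 then run c1 m else run c2 m
  | CFor k c =>
      iter (m 0 1) (fun m' => store (run c m') k 0 (run c m' k 0 + 1))
           (store m k 0 0)
  end.

Fixpoint assigned (c : cmd) : seq nat :=
  match c with
  | CSkip => [::]
  | CWrite a _ _ => [:: a]
  | CSeq c1 c2 | CIf _ c1 c2 => assigned c1 ++ assigned c2
  | CFor k c => k :: assigned c
  end.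

(** The first operand of [Sub] or [Div] bounds the result, so the second is unrestricted. So is the
    address of a [Read], whose value is already in memory. *)
Fixpoint mul_free (e : expr) : bool :=
  match e with
  | Const _ | Read _ _ => true
  | Bin Add e1 e2 => mul_free e1 && mul_free e2
  | Bin Mul _ _ => false
  | Bin _ e1 _ => mul_free e1
  end.

(** The input array, which holds the number of nodes, is never written, and a loop body does not
    touch its counter: the number of iterations is fixed. *)
Fixpoint well_formed (c : cmd) : bool :=
  match c with
  | CSkip => true
  | CWrite a _ e2 => (a != 0) && mul_free e2
  | CSeq c1 c2 | CIf _ c1 c2 => well_formed c1 && well_formed c2
  | CFor k c => [&& k != 0, k \notin assigned c & well_formed c]
  end.

Lemma storeE m a i v a' i' :
  store m a i v a' i' = if (a' == a) && (i' == i) then v else m a' i'.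
Proof. by []. Qed.

Lemma store_other m a i v a' i' : a' != a -> store m a i v a' i' = m a' i'.
Proof. by rewrite storeE => /negbTE ->. Qed.

Lemma run_frame c m a i : a \notin assigned c -> run c m a i = m a i.
Proof.
elim: c m => //= [b e1 e2|c1 IH1 c2 IH2|e c1 IH1 c2 IH2|k c IH] m.
- by rewrite inE => /store_other.
- by rewrite mem_cat negb_or => /andP[/IH1 E1 /IH2 E2]; rewrite E2 E1.
- rewrite mem_cat negb_or => /andP[/IH1 E1 /IH2 E2].
  by case: ifP.
- rewrite inE negb_or => /andP[ak /IH E].
  elim: (m 0 1) => [|d IHd] /=; first exact: store_other.
  by rewrite store_other // E.
Qed.

Lemma well_formed_input c : well_formed c -> 0 \notin assigned c.
Proof.
elim: c => //= [a e1 e2|c1 IH1 c2 IH2|e c1 IH1 c2 IH2|k c IH].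
- by rewrite inE eq_sym => /andP[].
- by move=> /andP[/IH1 ? /IH2 ?]; rewrite mem_cat negb_or; apply/andP.
- by move=> /andP[/IH1 ? /IH2 ?]; rewrite mem_cat negb_or; apply/andP.
- by move=> /and3P[k0 _ /IH ?]; rewrite inE negb_or eq_sym k0.
Qed.

Lemma bitlen_gt0 x : 0 < bitlen x. Proof. by []. Qed.

Lemma bitlen_leq x l : 0 < l -> (bitlen x <= l) = (x < 2 ^ l).
Proof.
move=> l0; rewrite /bitlen; apply/idP/idP => [xl|xl].
  by apply: leq_trans (trunc_log_ltn x (ltnSn 1)) _; rewrite leq_exp2l.
case: (posnP x) => [->|x0]; first by rewrite trunc_log0.
by rewrite -(ltn_exp2l _ _ (ltnSn 1)); apply: leq_ltn_trans xl; apply: trunc_logP.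
Qed.

Lemma bitlen_lt x : x < 2 ^ bitlen x.
Proof. by rewrite -bitlen_leq. Qed.

Lemma leq_bitlen x y : x <= y -> bitlen x <= bitlen y.
Proof. by move=> xy; rewrite bitlen_leq // (leq_ltn_trans xy) ?bitlen_lt. Qed.

Lemma bitlen_leqn x : 0 < x -> bitlen x <= x.
Proof. by move=> x0; rewrite bitlen_leq // ltn_expl. Qed.

Lemma bitlen_mul x y : bitlen (x * y) <= bitlen x + bitlen y.
Proof.
rewrite bitlen_leq // expnD.
have := bitlen_lt x; have := bitlen_lt y; nia.
Qed.

Lemma bitlen_add x y : bitlen (x + y) <= (maxn (bitlen x) (bitlen y)).+1.
Proof.
rewrite bitlen_leq // expnS.
have Hx : 2 ^ bitlen x <= 2 ^ maxn (bitlen x) (bitlen y).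
  by rewrite leq_exp2l // leq_maxl.
have Hy : 2 ^ bitlen y <= 2 ^ maxn (bitlen x) (bitlen y).
  by rewrite leq_exp2l // leq_maxr.
have := bitlen_lt x; have := bitlen_lt y; lia.
Qed.

Definition bounded (L : nat) (m : memory) : Prop :=
  forall a i, bitlen (m a i) <= L.

Lemma bounded_gt0 L m : bounded L m -> 0 < L.
Proof. by move=> /(_ 0 0); apply: leq_trans. Qed.

Lemma bounded_leq L L' m : L <= L' -> bounded L m -> bounded L' m.
Proof. by move=> LL' b a i; apply: leq_trans (b a i) LL'. Qed.

Fixpoint value_coef (e : expr) : nat :=
  match e with
  | Const c => bitlen c
  | Read _ _ => 1
  | Bin _ e1 e2 => value_coef e1 + value_coef e2
  end.

Fixpoint cost_coef (e : expr) : nat :=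
  match e with
  | Const c => bitlen c
  | Read _ e1 => cost_coef e1 + value_coef e1 + 1
  | Bin _ e1 e2 =>
      cost_coef e1 + cost_coef e2 + value_coef e1 + value_coef e2
  end.

Definition test_coef (e : expr) : nat := cost_coef e + value_coef e.

(** Multiplicative bounds on bit lengths suffice for costs, but stored values need an additive one:
    a factor applied at each iteration would compound exponentially. *)
Fixpoint growth (e : expr) : nat :=
  match e with
  | Const c => bitlen c
  | Read _ _ => 0
  | Bin _ e1 e2 => (growth e1 + growth e2).+1
  end.

Lemma eval_bound L m e : bounded L m ->
  bitlen (eval m e) <= value_coef e * L /\ eval_cost m e <= cost_coef e * L.
Proof.
move=> b; have L0 := bounded_gt0 b.
elim: e => [c|a e [IHv IHc]|o e1 [IHv1 IHc1] e2 [IHv2 IHc2]] /=.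
- by rewrite leq_pmulr.
- split; first by rewrite mul1n.
  rewrite !mulnDl mul1n; have := b a (eval m e); lia.
- split; last by rewrite !mulnDl; lia.
  rewrite mulnDl; case: o => /=.
  + apply: leq_trans (bitlen_add _ _) _.
    have := bitlen_gt0 (eval m e1); have := bitlen_gt0 (eval m e2); lia.
  + apply: leq_trans (leq_bitlen (leq_subr _ _)) _; lia.
  + apply: leq_trans (bitlen_mul _ _) _; lia.
  + apply: leq_trans (leq_bitlen (leq_div _ _)) _; lia.
Qed.

Lemma test_cost_bound L m e : bounded L m -> test_cost m e <= test_coef e * L.
Proof. by move=> /eval_bound-/(_ e)[v c]; rewrite mulnDl leq_add. Qed.

Lemma eval_growth L m e : bounded L m -> mul_free e ->
  bitlen (eval m e) <= L + growth e.
Proof.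
move=> b; elim: e => [c _|a e _ _|o e1 IH1 e2 IH2] /=.
- by rewrite leq_addl.
- by rewrite addn0.
- case: o => //=.
  + move=> /andP[/IH1 E1 /IH2 E2]; apply: leq_trans (bitlen_add _ _) _; lia.
  + by move=> /IH1 E1; apply: leq_trans (leq_bitlen (leq_subr _ _)) _; lia.
  + by move=> /IH1 E1; apply: leq_trans (leq_bitlen (leq_div _ _)) _; lia.
Qed.

Lemma bounded_store L m a i v :
  bounded L m -> bitlen v <= L -> bounded L (store m a i v).
Proof. by move=> b vL a' i'; rewrite storeE; case: ifP. Qed.

Definition loop_work (k : nat) : nat :=
  test_coef (Bin Defs.Sub nodes (var k)) + test_coef (Const 0)
  + test_coef (incr k) + growth (incr k).

(* An upper bound both for the number of operations, weighted by the sizes of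
   the expressions, and for the number of bits by which the cells can grow. *)
Fixpoint work (c : cmd) (n : nat) : nat :=
  match c with
  | CSkip => 1
  | CWrite _ e1 e2 => test_coef e1 + test_coef e2 + growth e2
  | CSeq c1 c2 => work c1 n + work c2 n
  | CIf e c1 c2 => test_coef e + work c1 n + work c2 n
  | CFor k c =>
      2 * test_coef (Const 0) + loop_work k + n * (work c n + loop_work k)
  end.

(** The cells gain at most [W] bits in all, an operation costs at most its coefficient times the
    bound [L + W], and the coefficients sum to at most [W]. *)
Lemma compile_exec c m L : well_formed c -> bounded L m ->
  let W := work c (m 0 1) in
  bounded (L + W) (run c m) /\
  exists2 t, exec (compile c) m (run c m) t & t <= W * (L + W).
Proof.
elim: c m L => [|a e1 e2|c1 IH1 c2 IH2|e c1 IH1 c2 IH2|k c IH] m L /=.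
- move=> _ b; split; first by apply: bounded_leq b; rewrite leq_addr.
  by exists 1; [exact: ExecSkip | rewrite mul1n addn1].
- move=> /andP[_ mf] b; split.
    apply: bounded_store; first by apply: bounded_leq b; rewrite leq_addr.
    by apply: leq_trans (eval_growth b mf) _; lia.
  exists (test_cost m e1 + test_cost m e2); first exact: ExecWrite.
  have := test_cost_bound e1 b; have := test_cost_bound e2 b; nia.
- move=> /andP[w1 w2] b.
  have [b1 [t1 x1 h1]] := IH1 m L w1 b.
  have [b2 [t2 x2 h2]] := IH2 (run c1 m) _ w2 b1.
  rewrite run_frame ?well_formed_input // in b2 h2.
  split; first by apply: bounded_leq b2; rewrite addnA.
  exists (t1 + t2); first exact: ExecSeq x1 x2.
  nia.
- move=> /andP[w1 w2] b; have te := test_cost_bound e b.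
  case: ifP => [en|/negbFE/eqP en].
    have [b1 [t1 x1 h1]] := IH1 m L w1 b.
    split; first by apply: bounded_leq b1; lia.
    exists (test_cost m e + t1); first exact: ExecIfTrue.
    nia.
  have [b2 [t2 x2 h2]] := IH2 m L w2 b.
  split; first by apply: bounded_leq b2; lia.
  exists (test_cost m e + t2); first exact: ExecIfFalse.
  nia.
- move=> /and3P[k0 kc w] b.
  set n := m 0 1; set f := fun m' => _.
  (* Here [d] counts the iterations left; [iterSr] peels off the first one, as the rule for [While]
     does. *)
  have loop d : forall m' L', bounded L' m' -> m' 0 1 = n -> m' k 0 + d = n ->
    let W := d * (work c n + loop_work k) in
    bounded (L' + W) (iter d f m') /\
    exists2 t, exec (While (Bin Defs.Sub nodes (var k))
                 (Seq (compile c) (Write k (Const 0) (incr k)))) m' (iter d f m') t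
             & t <= (W + loop_work k) * (L' + W).
    elim: d => [|d IHd] m' L' b' m'n m'k.
      split; first by rewrite addn0.
      eexists; first by apply: ExecWhileFalse; rewrite /= m'n; lia.
      have := test_cost_bound (Bin Defs.Sub nodes (var k)) b'.
      rewrite /loop_work; nia.
    rewrite iterSr; set W := work c n + loop_work k.
    have [b1 [t1 x1 h1]] := IH m' L' w b'.
    rewrite m'n in b1 h1.
    have e01 : run c m' 0 1 = n by rewrite run_frame ?well_formed_input.
    have ek : run c m' k 0 = m' k 0 by rewrite run_frame.
    have b2 : bounded (L' + W) (f m').
      apply: bounded_store; first by apply: bounded_leq b1; rewrite /W; lia.
      apply: leq_trans (eval_growth (e := incr k) b1 isT) _.
      by rewrite /W /loop_work; lia.
    have [] := IHd (f m') _ b2.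
    + by rewrite /f store_other // eq_sym.
    + by rewrite /f storeE !eqxx /= ek; lia.
    rewrite -/W => b3 [t3 x3 h3]; split.
      by apply: bounded_leq b3; rewrite mulSn addnA.
    eexists.
      apply: ExecWhileTrue x3; first by rewrite /= m'n; lia.
      by apply: ExecSeq x1 _; exact: ExecWrite.
    have := test_cost_bound (Bin Defs.Sub nodes (var k)) b'.
    have := test_cost_bound (Const 0) b1.
    have := test_cost_bound (incr k) b1.
    rewrite mulSn.
    set T1 := test_cost _ _; set T2 := test_cost _ _; set T3 := test_cost _ _.
    rewrite -addnA in h3.
    have LL : L' + work c n <= L' + (W + d * W) by rewrite /W; lia.
    have LL' : L' <= L' + (W + d * W) by lia.
    (* Every cost is bounded by its coefficient times the final bound [LF], so that only
       coefficients remain to be added. *)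
    set LF := L' + (W + d * W) in h3 LL LL' *.
    move=> q1 q2 q3.
    have q1' := leq_trans q1 (leq_mul (leqnn _) LL).
    have q2' := leq_trans q2 (leq_mul (leqnn _) LL).
    have q3' := leq_trans q3 (leq_mul (leqnn _) LL').
    have h1' := leq_trans h1 (leq_mul (leqnn _) LL).
    move: h3 h1' q1' q2' q3'; rewrite /W /loop_work.
    move: (test_coef (Bin _ _ _)) (test_coef (Const 0)) (test_coef (incr k)).
    move: (growth _) (work c n); clearbody T1 T2 T3 LF; clear.
    by move=> g w A1 A2 A3; rewrite !mulnDl; lia.
  have b0 : bounded (L + 1) (store m k 0 0).
    apply: bounded_store; first by apply: bounded_leq b; lia.
    by rewrite /bitlen trunc_log0 leq_addl.
  have [] := loop n _ _ b0.
  + by rewrite store_other // eq_sym.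
  + by rewrite storeE !eqxx.
  set W := n * _ => b1 [t1 x1 h1].
  have Z : 0 < test_coef (Const 0) by [].
  split; first by apply: bounded_leq b1; lia.
  eexists; first by apply: ExecSeq x1; exact: ExecWrite.
  have := test_cost_bound (Const 0) b.
  set T := test_cost _ _ => q.
  set C := test_coef _ in Z q *.
  have LL' : L <= L + (2 * C + loop_work k + W) by lia.
  have LL : L + 1 + W <= L + (2 * C + loop_work k + W) by lia.
  have q' := leq_trans q (leq_mul (leqnn _) LL').
  have h1' := leq_trans h1 (leq_mul (leqnn _) LL).
  move: q' h1'; set LF := L + (2 * C + _ + _); clearbody LF C T W.
  by move: (loop_work k) => l; clear; rewrite !mulnDl; lia.
Qed.

(** Every loop ranges over the nodes and raises the degree by one. *)
Lemma work_poly c : exists A d, forall n, work c n <= A * n.+1 ^ d.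
Proof.
have mono A d d' n : d <= d' -> A * n.+1 ^ d <= A * n.+1 ^ d'.
  by move=> dd; rewrite leq_mul2l leq_pexp2l ?orbT.
elim: c => [|a e1 e2|c1 [A1 [d1 IH1]] c2 [A2 [d2 IH2]]
           |e c1 [A1 [d1 IH1]] c2 [A2 [d2 IH2]]|k c [A [d IH]]] /=.
- by exists 1, 0 => n.
- by eexists _, 0 => n; rewrite expn0 muln1.
- exists (A1 + A2), (maxn d1 d2) => n; rewrite mulnDl leq_add //.
    by apply: leq_trans (IH1 n) (mono _ _ _ n (leq_maxl _ _)).
  by apply: leq_trans (IH2 n) (mono _ _ _ n (leq_maxr _ _)).
- exists (test_coef e + A1 + A2), (maxn d1 d2) => n.
  move: (test_coef e) => T; rewrite !mulnDl !leq_add //.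
  + by rewrite leq_pmulr // expn_gt0.
  + by apply: leq_trans (IH1 n) (mono _ _ _ n (leq_maxl _ _)).
  + by apply: leq_trans (IH2 n) (mono _ _ _ n (leq_maxr _ _)).
- set B := loop_work k; set C := 2 * _.
  exists (C + B + (A + B)), d.+1 => n.
  have X0 : 0 < n.+1 ^ d by rewrite expn_gt0.
  have := IH n; rewrite expnS; set X := n.+1 ^ d in X0 *.
  move: (work c n) X X0 => w X X0 wA.
  have h1 : C + B <= (C + B) * (n.+1 * X) by nia.
  have h2 : n * (w + B) <= n.+1 * ((A + B) * X) by apply: leq_mul => //; nia.
  rewrite (mulnDl (C + B)); nia.
Qed.

Lemma size_bitsize w : size w <= bitsize w.
Proof.
elim: w => [|x w IH]; rewrite /bitsize ?big_cons //= -/(bitsize w).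
by rewrite -add1n leq_add.
Qed.

Lemma bitlen_bitsize w x : x \in w -> bitlen x <= bitsize w.
Proof.
elim: w => // y w IH; rewrite inE /bitsize big_cons -/(bitsize w).
by move=> /orP[/eqP ->|/IH]; lia.
Qed.

Lemma load_input_bounded w : w != [::] -> bounded (bitsize w) (load_input w).
Proof.
move=> w0 a i; rewrite /load_input.
have sw : 0 < size w by rewrite lt0n size_eq0.
have b1 : 1 <= bitsize w by apply: leq_trans (size_bitsize w).
have bit0 : bitlen 0 <= bitsize w by rewrite /bitlen trunc_log0.
case: ifP => // _; case: i => [|i] /=.
  by apply: leq_trans (bitlen_leqn sw) (size_bitsize w).
case: (ltnP i (size w)) => iw; first exact: bitlen_bitsize (mem_nth _ iw).
by rewrite nth_default.
Qed.

Lemma poly_time_run (X : Type) (encode : X -> seq nat)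
    (promise : X -> Prop) (sol : X -> seq nat -> Prop) (c : cmd) :
  well_formed c ->
  (forall x, encode x != [::]) ->
  (forall x, head 0 (encode x) <= size (encode x)) ->
  (forall x, promise x -> sol x (read_output (run c (load_input (encode x))))) ->
  poly_time_solvable encode promise sol.
Proof.
move=> wf nonempty hd correct.
have [A [d wA]] := work_poly c.
(* With [N] the bit size, the work is at most [A * (2 * N) ^ d] and the bit lengths are at most
   [(1 + A) * (2 * N) ^ d.+1]; the time is bounded by the product. *)
exists (compile c), (A * (1 + A) * 2 ^ (d + d).+1), (d + d).+1 => x px.
set w := encode x.
have bw := load_input_bounded (nonempty x).
have [_ [t xt tle]] := compile_exec wf bw.
exists (run c (load_input w)), t; split=> //; last exact: correct.
have b1 := bounded_gt0 bw; rewrite -/w in b1 tle.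
have nle : (load_input w 0 1).+1 <= 2 * bitsize w.
  have := leq_trans (hd x) (size_bitsize w); rewrite -/w /load_input /= nth0; lia.
have {}wA : work c (load_input w 0 1) <= A * (2 * bitsize w) ^ d.
  apply: leq_trans (wA _) _; rewrite leq_mul2l; apply/orP; right.
  by case: (d) => // d'; rewrite leq_exp2r.
apply: leq_trans (leq_addr _ _); apply: leq_trans tle _.
set N := bitsize w in b1 wA *; set W := work _ _ in wA *.
rewrite -mulnA -expnMn; set Y := (2 * N) ^ d in wA.
have Y0 : 0 < Y by rewrite expn_gt0 muln_gt0 b1.
rewrite expnS expnD -/Y.
have h1 : N + W <= (1 + A) * (2 * N * Y) by nia.
apply: leq_trans (leq_mul wA h1) _.
by rewrite leq_eqVlt; apply/orP; left; apply/eqP; nia.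
Qed.

(** * The program and its correctness *)

Section Loops.

Variable n : nat.

(** Invariant rule: [P] is indexed by the nodes already treated, and must survive any change of the
    counter. *)
Lemma run_for k c (P : seq 'I_n -> memory -> Prop) m :
  k != 0 -> 0 \notin assigned c -> k \notin assigned c -> m 0 1 = n ->
  (forall s m' x, P s m' -> P s (store m' k 0 x)) ->
  (forall s (i : 'I_n) m', (forall a, m' 0 a = m 0 a) -> m' k 0 = i ->
     P s m' -> P (rcons s i) (run c m')) ->
  P [::] m -> P (enum 'I_n) (run (CFor k c) m).
Proof.
move=> k0 c0 ck m_n stable step Pm /=.
set f := fun m' => _.
have loop d : d <= n -> let m' := iter d f (store m k 0 0) in
    [/\ forall a, m' 0 a = m 0 a, m' k 0 = d & P (take d (enum 'I_n)) m'].
  elim: d => [|d IH] dn /=.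
    rewrite take0; split; last exact: stable.
    - by move=> a; rewrite store_other // eq_sym.
    - by rewrite storeE !eqxx.
  have [] := IH (ltnW dn); move: (iter d f _) => m' inp mk Pd; split.
  - by move=> a; rewrite /f store_other ?run_frame // eq_sym.
  - by rewrite /f storeE !eqxx run_frame // mk addn1.
  - apply: stable; rewrite (take_nth (Ordinal dn)) ?size_enum_ord //.
    by apply: step; rewrite // mk nth_enum_ord.
rewrite m_n; have [_ _] := loop n (leqnn n).
by rewrite take_oversize // size_enum_ord.
Qed.

Definition pairs : seq ('I_n * 'I_n) :=
  [seq (i, j) | i <- enum 'I_n, j <- enum 'I_n].

Lemma mem_pairs ij : ij \in pairs.
Proof. by case: ij => i j; apply/allpairsP; exists (i, j); rewrite !mem_enum. Qed.

Lemma run_for2 k l c (P : seq ('I_n * 'I_n) -> memory -> Prop) m :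
  k != 0 -> l != 0 -> k != l ->
  0 \notin assigned c -> k \notin assigned c -> l \notin assigned c ->
  m 0 1 = n ->
  (forall s m' x, P s m' -> P s (store m' k 0 x)) ->
  (forall s m' x, P s m' -> P s (store m' l 0 x)) ->
  (forall s (i j : 'I_n) m', (forall a, m' 0 a = m 0 a) ->
     m' k 0 = i -> m' l 0 = j -> P s m' -> P (rcons s (i, j)) (run c m')) ->
  P [::] m -> P pairs (run (CFor k (CFor l c)) m).
Proof.
move=> k0 l0 kl c0 ck cl m_n stab_k stab_l step.
move=> P0; pose R (s : seq 'I_n) := P [seq (i, j) | i <- s, j <- enum 'I_n].
suff : R (enum 'I_n) (run (CFor k (CFor l c)) m) by [].
apply: run_for => //=.
- by rewrite inE negb_or eq_sym l0.
- by rewrite inE negb_or kl.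
- by move=> s m' x; exact: stab_k.
rewrite /R.
move=> s i m' inp mk Pm.
set s' := [seq (i, j) | i <- s, j <- _] in Pm.
have -> : [seq (i0, j) | i0 <- rcons s i, j <- enum 'I_n] =
    s' ++ [seq (i, j) | j <- enum 'I_n].
  by rewrite /s' -cats1 allpairs_cat /= cats0.
(* The inner invariant also records the outer counter, which the body reads. *)
pose Q (t : seq 'I_n) m := P (s' ++ [seq (i, j) | j <- t]) m /\ m k 0 = i.
suff [] : Q (enum 'I_n) (run (CFor l c) m') by [].
apply: run_for => //; first by rewrite inp.
- move=> t m1 x [P1 m1k]; split; first exact: stab_l.
  by rewrite store_other.
- move=> t j m1 inp1 m1l [P1 m1k]; split; last by rewrite run_frame.
  by rewrite map_rcons -rcons_cat; apply: step => // a; rewrite inp1.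
- by split; rewrite ?cats0.
Qed.

End Loops.

(* An injective code for pairs; unlike i * n + j it does not involve a bound. *)
Definition pairing (i j : nat) : nat := (i + j) * (i + j) + i.

Lemma eq_pairing i j i' j' :
  (pairing i j == pairing i' j') = (i == i') && (j == j').
Proof.
apply/eqP/andP => [|[/eqP -> /eqP ->] //]; rewrite /pairing => e.
(* The code lies between the consecutive squares of [i + j] and [i + j + 1], so it determines this
   sum. *)
have s : i + j = i' + j' by nia.
have ei : i = i' by rewrite s in e; lia.
by split; apply/eqP; lia.
Qed.

Definition pairing_expr (e1 e2 : expr) : expr :=
  Bin Add (Bin Mul (Bin Add e1 e2) (Bin Add e1 e2)) e1.

Definition entry (a : nat) (e1 e2 : expr) : expr := Read a (pairing_expr e1 e2).

Lemma eval_const m c : eval m (Const c) = c. Proof. by []. Qed.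

Lemma eval_var m a : eval m (var a) = m a 0. Proof. by []. Qed.

Lemma eval_read m a e : eval m (Read a e) = m a (eval m e). Proof. by []. Qed.

Lemma eval_add m e1 e2 : eval m (Bin Add e1 e2) = eval m e1 + eval m e2.
Proof. by []. Qed.

Lemma eval_sub m e1 e2 : eval m (Bin Defs.Sub e1 e2) = eval m e1 - eval m e2.
Proof. by []. Qed.

Lemma eval_mul m e1 e2 : eval m (Bin Mul e1 e2) = eval m e1 * eval m e2.
Proof. by []. Qed.

Lemma eval_pairing m e1 e2 :
  eval m (pairing_expr e1 e2) = pairing (eval m e1) (eval m e2).
Proof. by []. Qed.

Definition evalE := (eval_var, eval_pairing, eval_const, eval_read, eval_add,
  eval_sub, eval_mul).

Lemma run_skip m : run CSkip m = m. Proof. by []. Qed.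

Lemma run_write a e1 e2 m :
  run (CWrite a e1 e2) m = store m a (eval m e1) (eval m e2).
Proof. by []. Qed.

Lemma run_seq c1 c2 m : run (CSeq c1 c2) m = run c2 (run c1 m).
Proof. by []. Qed.

Lemma run_if e c1 c2 m :
  run (CIf e c1 c2) m = if eval m e != 0 then run c1 m else run c2 m.
Proof. by []. Qed.

Definition runE := (run_skip, run_write, run_seq, run_if).

#[local] Arguments eval : simpl never.
#[local] Arguments run : simpl never.

(* Arrays of the program: 2 to 5, loop indices; 8, the distance matrix of the
   current forest (1 plus the distance, or 0); 11 and 12, the eccentricity (plus
   1) of each vertex and the radius (plus 1) of its component; 13 and 14, the
   hub and its radius; 15, whether the star wins; 16 and 17, numerator and
   denominator of the largest requirement; 18 and 19, columns of array 8. *)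

Section Linking.

Variable n : nat.
Implicit Types (E : 'I_n -> 'I_n -> nat) (m : memory) (x y u v : 'I_n).

Definition stores E m : Prop := forall x y, m 8 (pairing x y) = E x y.

Definition init_cmd : cmd :=
  CFor 2 (CWrite 8 (pairing_expr (var 2) (var 2)) (Const 1)).

Lemma run_init m : m 0 1 = n -> (forall a, m 8 a = 0) ->
  stores (fun x y => (x == y) : nat) (run init_cmd m).
Proof.
move=> m_n m8.
pose P (s : seq 'I_n) m' := forall x y, m' 8 (pairing x y) = (x == y) && (x \in s).
suff : P (enum 'I_n) (run init_cmd m).
  by move=> e x y; rewrite e mem_enum andbT.
apply: (run_for (P := P)) => //.
- move=> s i m' _ mi Pm x y.
  rewrite !runE storeE !evalE mi /= eq_pairing !val_eqE Pm mem_rcons inE.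
  by have [<-|xi] := eqVneq x i; rewrite 1?[_ == x]eq_sym //; case: (x == y).
- by move=> x y; rewrite m8 andbF.
Qed.

Definition merge_cmd : cmd :=
  CFor 4 (CFor 5
    (CIf (Read 18 (var 4)) (CIf (Read 19 (var 5))
      (CSeq
        (CWrite 8 (pairing_expr (var 4) (var 5))
          (Bin Add (Read 18 (var 4)) (Read 19 (var 5))))
        (CWrite 8 (pairing_expr (var 5) (var 4))
          (Bin Add (Read 18 (var 4)) (Read 19 (var 5)))))
      CSkip) CSkip)).

Lemma run_merge E u v m : m 0 1 = n -> stores E m -> forest_mx E ->
  E u v = 0 -> (forall x, m 18 x = E x u) -> (forall x, m 19 x = E x v) ->
  stores (link E u v) (run merge_cmd m).
Proof.
move=> m_n mE fE uv mP mQ.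
(* Treating a pair writes both symmetric entries, so an entry is final once the pair has been met in
   the order that leads from [u] to [v]. *)
pose P (s : seq ('I_n * 'I_n)) m' :=
  [/\ forall x, m' 18 x = E x u, forall x, m' 19 x = E x v &
    forall x y, m' 8 (pairing x y) =
      if [&& (x, y) \in s, E x u != 0 & E y v != 0] then E x u + E y v
      else if [&& (y, x) \in s, E y u != 0 & E x v != 0] then E y u + E x v
      else E x y].
suff [_ _ P8] : P (pairs n) (run merge_cmd m).
  by move=> x y; rewrite P8 !mem_pairs.
apply: (run_for2 (P := P)) => // s i j m' _ m'4 m'5 [PP PQ PE].
rewrite !runE !evalE m'4 m'5 PP PQ.
have sep x : E x u != 0 -> E x v != 0 -> False.
  by move=> xu xv; case/negP: (link_sep fE uv x); rewrite xu xv.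
case: ifP => iu; last first.
  split=> // x y; rewrite PE !mem_rcons !inE !xpair_eqE.
  have [->|_] := eqVneq x i; have [->|_] := eqVneq y i; rewrite /= ?iu ?andbF //=;
  by rewrite ?andbF.
case: ifP => jv; last first.
  split=> // x y; rewrite PE !mem_rcons !inE !xpair_eqE.
  have [->|_] := eqVneq x j; have [->|_] := eqVneq y j; rewrite /= ?jv ?andbF //=;
  by rewrite ?andbF.
split=> // x y; rewrite !storeE /= ?evalE m'4 m'5 PP PQ.
rewrite !eq_pairing !val_eqE PE !mem_rcons !inE !xpair_eqE (andbC (y == i)).
case: ifP => [/andP[/eqP -> /eqP ->]|_].
  have -> : (E j u != 0) = false by apply/negbTE/negP => /sep/(_ jv).
  by rewrite iu jv !andbF.
by case: ifP => [/andP[/eqP -> /eqP ->]|_] //=; rewrite iu jv.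
Qed.

(** The two columns are copied beforehand because merging makes zero entries of these very columns
    nonzero. *)
Definition link_cmd (a b : nat) : cmd :=
  CIf (entry 8 (var a) (var b)) CSkip
   (CSeq
     (CFor 4 (CSeq (CWrite 18 (var 4) (entry 8 (var 4) (var a)))
                   (CWrite 19 (var 4) (entry 8 (var 4) (var b)))))
     merge_cmd).

Lemma run_link m E u v a b : m 0 1 = n -> stores E m -> forest_mx E ->
  m a 0 = u -> m b 0 = v ->
  a \notin assigned (link_cmd a b) -> b \notin assigned (link_cmd a b) ->
  stores (join E u v) (run (link_cmd a b) m).
Proof.
move=> m_n mE fE ma mb aa ab; rewrite /join run_if !evalE ma mb mE.
have [nz|/negPn/eqP uv] := boolP (E u v != 0); first by [].
rewrite run_seq; set m1 := run (CFor 4 _) m.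
have [m1a m1b m1E m1P m1Q] : [/\ m1 a 0 = u, m1 b 0 = v, stores E m1,
    forall x, m1 18 x = E x u & forall x, m1 19 x = E x v].
  pose P (s : seq 'I_n) m' := [/\ m' a 0 = u, m' b 0 = v, stores E m',
    forall x, x \in s -> m' 18 x = E x u & forall x, x \in s -> m' 19 x = E x v].
  have [] : P (enum 'I_n) m1; last first.
    by move=> ? ? ? p q; split=> // x; rewrite ?p ?q ?mem_enum.
  have ne d : d \notin assigned (link_cmd a b) -> [/\ d != 4, d != 18 & d != 19].
    by rewrite /= !inE !negb_or => /and4P[].
  have [[a4 a18 a19] [b4 b18 b19]] := (ne _ aa, ne _ ab).
  apply: (run_for (P := P)) => //.
  - move=> s m' x [Pa Pb PE PP PQ]; split=> //; by rewrite store_other.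
  - move=> s i m' inp m'4 [Pa Pb PE PP PQ]; rewrite !runE !evalE.
    split; rewrite ?store_other // => x; rewrite mem_rcons inE !storeE /=;
      rewrite m'4 ?Pa ?Pb PE val_eqE.
    + by case: eqVneq => [-> //|_ /= /PP].
    + by case: eqVneq => [-> //|_ /= /PQ].
by apply: run_merge => //; rewrite /m1 run_frame.
Qed.

End Linking.

Lemma rat_absz (x : rat) : (0 <= x)%R ->
  x = ((`|numq x|%N)%:R / (`|denq x|%N)%:R)%R.
Proof.
by move=> x0; rewrite -{1}[x]divq_num_den !natr_absz !ger0_norm ?numq_ge0.
Qed.

Lemma absz_denq_gt0 (x : rat) : 0 < `|denq x|.
Proof. by rewrite absz_gt0 denq_eq0. Qed.

(** Fractions are compared by cross-multiplication, a truncated difference being nonzero exactly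
    under strict inequality. *)
Lemma ratio_lt (x : rat) (c k p q : nat) : (0 <= x)%R -> 0 < q ->
  (`|numq x| * k * q - c * p * `|denq x| != 0) =
  (c%:R * (p%:R / q%:R) < x * k%:R)%R.
Proof.
move=> x0 q0; rewrite subn_eq0 -ltnNge.
rewrite [in RHS](rat_absz x0) mulrAC ltr_pdivlMr ?ltr0n ?absz_denq_gt0 //.
by rewrite mulrA mulrAC ltr_pdivrMr ?ltr0n // -!natrM ltr_nat.
Qed.

Lemma ratio_gt (x : rat) (p q : nat) : (0 <= x)%R -> 0 < q ->
  (p * `|denq x| - `|numq x| * q != 0) = (x < p%:R / q%:R)%R.
Proof.
move=> x0 q0; rewrite subn_eq0 -ltnNge.
rewrite [in RHS](rat_absz x0) ltr_pdivrMr ?ltr0n ?absz_denq_gt0 //.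
by rewrite mulrAC ltr_pdivlMr ?ltr0n // -!natrM ltr_nat.
Qed.

(** Before the requirements come the length of the input, the number of nodes, and two cells for
    each of the [n * n] distances. *)
Definition req_expr : expr :=
  Bin Add (Const 2) (Bin Mul (Const 2)
    (Bin Add (Bin Mul nodes nodes) (Bin Add (Bin Mul (var 2) nodes) (var 3)))).

Definition num_expr : expr := Read 0 req_expr.

Definition den_expr : expr := Read 0 (Bin Add req_expr (Const 1)).

Definition exceeds_expr (c : nat) (e : expr) : expr :=
  Bin Defs.Sub (Bin Mul (Bin Mul num_expr e) (var 17))
               (Bin Mul (Bin Mul (Const c) (var 16)) den_expr).

Definition below_expr : expr :=
  Bin Defs.Sub (Bin Mul (var 16) den_expr) (Bin Mul num_expr (var 17)).

(** * The largest requirement and the forest of its pairs *)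

Section Requirements.

Variables (n : nat) (r : 'I_n -> 'I_n -> rat).
Hypothesis r_ge0 : forall i j, (0 <= r i j)%R.
Implicit Types (m : memory) (b : rat) (E : 'I_n -> 'I_n -> nat).

Definition req_addr (i j : nat) : nat := 2 + 2 * (n * n + (i * n + j)).

Definition input m : Prop := m 0 1 = n /\
  forall i j : 'I_n, m 0 (req_addr i j) = `|numq (r i j)| /\
    m 0 (req_addr i j + 1) = `|denq (r i j)|.

Lemma input_eq m m' : input m -> (forall a, m' 0 a = m 0 a) -> input m'.
Proof. by move=> [m_n mr] e; split=> [|i j]; rewrite !e. Qed.

Lemma eval_num_den m (i j : 'I_n) : input m -> m 2 0 = i -> m 3 0 = j ->
  eval m num_expr = `|numq (r i j)| /\ eval m den_expr = `|denq (r i j)|.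
Proof.
move=> [m_n mr] mi mj; have [<- <-] := mr i j.
by rewrite /num_expr /den_expr /req_expr /nodes !evalE mi mj m_n.
Qed.

Definition has_bound b m : Prop :=
  0 < m 17 0 /\ b = ((m 16 0)%:R / (m 17 0)%:R)%R.

Lemma eval_exceeds m b c e (i j : 'I_n) : input m -> has_bound b m ->
  m 2 0 = i -> m 3 0 = j ->
  (eval m (exceeds_expr c e) != 0) = (c%:R * b < r i j * (eval m e)%:R)%R.
Proof.
move=> inp [q0 ->] mi mj; have [en ed] := eval_num_den inp mi mj.
by rewrite -ratio_lt // /exceeds_expr !eval_sub !eval_mul en ed !evalE.
Qed.

Lemma eval_below m b (i j : 'I_n) : input m -> has_bound b m ->
  m 2 0 = i -> m 3 0 = j -> (eval m below_expr != 0) = (r i j < b)%R.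
Proof.
move=> inp [q0 ->] mi mj; have [en ed] := eval_num_den inp mi mj.
by rewrite -ratio_gt // /below_expr !eval_sub !eval_mul en ed !evalE.
Qed.

Definition max_cmd : cmd :=
  CSeq (CWrite 17 (Const 0) (Const 1))
   (CFor 2 (CFor 3
     (CIf (Bin Defs.Sub (var 3) (var 2))
       (CIf (exceeds_expr 1 (Const 1))
         (CSeq (CWrite 16 (Const 0) num_expr) (CWrite 17 (Const 0) den_expr))
         CSkip)
       CSkip))).

(** The maximum starts from the fraction 0/1 and keeps this value when no pair has a positive
    requirement. *)
Lemma run_max m : input m -> m 16 0 = 0 -> exists b,
  [/\ has_bound b (run max_cmd m),
      forall i j : 'I_n, i < j -> (r i j <= b)%R
    & b = 0%R \/ exists i j, i != j /\ b = r i j].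
Proof.
move=> inp m16.
pose P (s : seq ('I_n * 'I_n)) m' := exists b,
  [/\ has_bound b m', forall i j : 'I_n, (i, j) \in s -> i < j -> (r i j <= b)%R
    & b = 0%R \/ exists i j, i != j /\ b = r i j].
suff [b [hb ub at_]] : P (pairs n) (run max_cmd m).
  by exists b; split=> // i j; apply: ub; rewrite mem_pairs.
rewrite /max_cmd run_seq run_write.
apply: (run_for2 (P := P)) => //.
- by case: inp.
- move=> s i j m' e m2 m3 [b [hb ub at_]]; have {}inp := input_eq inp e.
  rewrite !runE eval_sub !eval_var m2 m3 subn_eq0 -ltnNge.
  case: ifP => [ij|ij]; last first.
    exists b; split=> // x y; rewrite mem_rcons inE xpair_eqE.
    by move=> /orP[/andP[/eqP -> /eqP ->]|/ub //]; rewrite ij.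
  rewrite (eval_exceeds _ _ inp hb m2 m3) eval_const !mul1r mulr1.
  case: ltP => [lt|ge]; last first.
    exists b; split=> // x y; rewrite mem_rcons inE xpair_eqE.
    by move=> /orP[/andP[/eqP -> /eqP ->]|/ub //].
  exists (r i j); split.
  + have [en _] := eval_num_den inp m2 m3.
    have inp16 : input (store m' 16 0 (eval m' num_expr)).
      exact: input_eq inp _.
    have [_ ed] := eval_num_den inp16 m2 m3.
    rewrite /has_bound !storeE /= ?eval_const ed en; split.
      exact: absz_denq_gt0.
    exact: rat_absz.
  + move=> x y; rewrite mem_rcons inE xpair_eqE.
    move=> /orP[/andP[/eqP -> /eqP ->] //|xy /(ub _ _ xy)] le.
    exact: le_trans le (ltW lt).
  + by right; exists i, j; rewrite -val_eqE neq_ltn ij.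
- exists 0%R; split=> //; last by left.
  by rewrite /has_bound !storeE /= m16 mul0r.
Qed.

Definition forest_cmd : cmd :=
  CFor 2 (CFor 3 (CIf below_expr CSkip (link_cmd 2 3))).

Hypothesis r_sym : forall i j, r i j = r j i.

(** The result is a spanning forest of the graph of the pairs of largest requirement, even if this
    graph has cycles. A diagonal pair that passes the test is already connected and changes
    nothing. *)
Lemma run_forest m b E0 : input m -> has_bound b m -> stores E0 m ->
  forest_mx E0 -> (forall i j, ~~ adj E0 i j) ->
  exists E, [/\ stores E (run forest_cmd m), forest_mx E,
    forall i j, adj E i j -> (b <= r i j)%R
  & forall i j, (b <= r i j)%R -> E i j != 0].
Proof.
move=> inp hb mE0 fE0 noadj.
pose P (s : seq ('I_n * 'I_n)) m' := has_bound b m' /\ exists E,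
  [/\ stores E m', forest_mx E, forall i j, adj E i j -> (b <= r i j)%R
    & forall i j, (i, j) \in s -> (b <= r i j)%R -> E i j != 0].
suff [_ [E [mE fE low high]]] : P (pairs n) (run forest_cmd m).
  by exists E; split=> // i j; apply: high; rewrite mem_pairs.
apply: (run_for2 (P := P)) => //.
- by case: inp.
- move=> s i j m' e m2 m3 [hb' [E [mE fE low high]]].
  have {}inp := input_eq inp e.
  rewrite run_if (eval_below inp hb' m2 m3); case: ltP => [lt|ge].
    split=> //; exists E; split=> // x y; rewrite mem_rcons inE xpair_eqE.
    by move=> /orP[/andP[/eqP -> /eqP ->]|/high //]; rewrite leNgt lt.
  split.
    by rewrite /has_bound !run_frame.
  exists (join E i j); split.
  + by apply: run_link => //; case: inp.
  + exact: join_forest.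
  + move=> x y /(join_adj fE)/or3P[/low //||] /andP[/eqP -> /eqP ->] //.
    by rewrite r_sym.
  + move=> x y; rewrite mem_rcons inE xpair_eqE.
    move=> /orP[/andP[/eqP -> /eqP ->] _|xy /(high _ _ xy) nz].
      exact: join_conn.
    by rewrite join_id.
- split=> //; exists E0; split=> // x y; by rewrite (negbTE (noadj x y)).
Qed.

End Requirements.

(** * Eccentricities, radii, the hub and its attachment *)

Section Radii.

Variable n : nat.
Implicit Types (m : memory) (E : 'I_n -> 'I_n -> nat).

Definition ecc_cmd : cmd :=
  CFor 2 (CFor 3
    (CIf (Bin Defs.Sub (entry 8 (var 2) (var 3)) (Read 11 (var 2)))
      (CWrite 11 (var 2) (entry 8 (var 2) (var 3))) CSkip)).

Lemma run_ecc m E : m 0 1 = n -> stores E m -> forest_mx E ->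
  (forall a, m 11 a = 0) ->
  (forall x y : 'I_n, E x y <= run ecc_cmd m 11 x) /\
  (forall x : 'I_n, exists y, E x y = run ecc_cmd m 11 x).
Proof.
move=> m_n mE fE m11.
pose P (s : seq ('I_n * 'I_n)) m' :=
  [/\ stores E m', forall x y, (x, y) \in s -> E x y <= m' 11 x
    & forall x : 'I_n, m' 11 x = 0 \/ exists y, E x y = m' 11 x].
suff [_ ub at_] : P (pairs n) (run ecc_cmd m).
  split=> [x y|x]; first by apply: ub; rewrite mem_pairs.
  (* The diagonal entry 1 excludes the initial value 0. *)
  have := ub x x (mem_pairs _); rewrite fmx_diag // => gt0.
  by case: (at_ x) => // e; rewrite e in gt0.
apply: (run_for2 (P := P)) => //.
- move=> s i j m' _ m2 m3 [m'E ub at_].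
  rewrite !runE !evalE m2 m3 m'E subn_eq0 -ltnNge; case: ltnP => [lt|ge].
    split=> // x; last first.
      rewrite !storeE /= val_eqE; case: eqVneq => [->|_]; last exact: at_.
      by right; exists j.
    move=> y; rewrite mem_rcons inE xpair_eqE storeE /= val_eqE.
    have [->|_] := eqVneq x i => /=; last exact: ub.
    by case/orP=> [/eqP -> //|/ub le]; apply: leq_trans le (ltnW lt).
  split=> // x y; rewrite mem_rcons inE xpair_eqE.
  by move=> /orP[/andP[/eqP -> /eqP ->]|/ub].
- by split=> // x; left.
Qed.

(** Array 12 starts with the eccentricity of the node itself, so that it always holds a value
    attained in its component. *)
Definition rad_cmd : cmd :=
  CSeq (CFor 2 (CWrite 12 (var 2) (Read 11 (var 2))))
   (CFor 2 (CFor 3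
     (CIf (entry 8 (var 2) (var 3))
       (CIf (Bin Defs.Sub (Read 12 (var 2)) (Read 11 (var 3)))
         (CWrite 12 (var 2) (Read 11 (var 3))) CSkip) CSkip))).

Lemma run_rad m E (ecc : 'I_n -> nat) : m 0 1 = n -> stores E m -> forest_mx E ->
  (forall x : 'I_n, m 11 x = ecc x) ->
  (forall x y : 'I_n, E x y != 0 -> run rad_cmd m 12 x <= ecc y) /\
  (forall x : 'I_n, exists2 c, E x c != 0 & ecc c = run rad_cmd m 12 x).
Proof.
move=> m_n mE fE m11; rewrite /rad_cmd run_seq.
set m1 := run (CFor 2 _) m.
have m1_12 (x : 'I_n) : m1 12 x = ecc x.
  pose Q (s : seq 'I_n) m' := (forall x : 'I_n, m' 11 x = ecc x) /\
    forall x : 'I_n, x \in s -> m' 12 x = ecc x.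
  suff [_ e] : Q (enum 'I_n) m1 by apply: e; rewrite mem_enum.
  apply: (run_for (P := Q)) => // s i m' _ m2 [e11 e12]; split=> // y.
  rewrite mem_rcons inE run_write !evalE storeE /= m2 val_eqE e11.
  by case: eqVneq => [->|_ /e12].
pose P (s : seq ('I_n * 'I_n)) m' :=
  [/\ stores E m', forall x : 'I_n, m' 11 x = ecc x,
      forall x y, (x, y) \in s -> E x y != 0 -> m' 12 x <= ecc y
    & forall x : 'I_n, exists2 c, E x c != 0 & ecc c = m' 12 x].
suff [_ _ lb at_] : P (pairs n) (run (CFor 2 (CFor 3
     (CIf (entry 8 (var 2) (var 3))
       (CIf (Bin Defs.Sub (Read 12 (var 2)) (Read 11 (var 3)))
         (CWrite 12 (var 2) (Read 11 (var 3))) CSkip) CSkip))) m1).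
  by split=> // x y; apply: lb; rewrite mem_pairs.
apply: (run_for2 (P := P)) => //.
- by rewrite /m1 run_frame.
- move=> s i j m' _ m2 m3 [m'E e11 lb at_].
  rewrite !runE !evalE m2 m3 m'E e11 subn_eq0 -ltnNge.
  case: ifP => [ij|/negbFE/eqP ij]; last first.
    split=> // x y; rewrite mem_rcons inE xpair_eqE.
    by move=> /orP[/andP[/eqP -> /eqP ->]|/lb //]; rewrite ij.
  case: ltnP => [lt|ge].
    split=> // x; last first.
      rewrite !storeE /= val_eqE; case: eqVneq => [->|_]; last exact: at_.
      by exists j.
    move=> y; rewrite mem_rcons inE xpair_eqE storeE /= val_eqE.
    have [->|_] := eqVneq x i => /=; last exact: lb.
    case/orP=> [/eqP -> //|/lb le nz]; apply: leq_trans (ltnW lt) _; exact: le.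
  split=> // x y; rewrite mem_rcons inE xpair_eqE.
  by move=> /orP[/andP[/eqP -> /eqP ->]|/lb].
- split=> //; first by move=> x y; rewrite /m1 run_frame.
  + by move=> x; rewrite /m1 run_frame.
  + by move=> x; exists x; rewrite ?fmx_diag.
Qed.

(** Only nodes whose eccentricity equals the radius are candidates. The value 0 in array 14 means
    that no hub has been found, all shifted radii being positive. *)
Definition hub_cmd : cmd :=
  CFor 2
    (CIf (Bin Defs.Sub (Read 12 (var 2)) (var 14))
      (CIf (Bin Defs.Sub (Read 11 (var 2)) (Read 12 (var 2))) CSkip
        (CSeq (CWrite 14 (Const 0) (Read 12 (var 2)))
              (CWrite 13 (Const 0) (var 2))))
      CSkip).

Lemma run_hub m (ecc rad : 'I_n -> nat) (x0 : 'I_n) : m 0 1 = n ->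
  (forall x : 'I_n, m 11 x = ecc x) -> (forall x : 'I_n, m 12 x = rad x) ->
  m 14 0 = 0 -> (forall x, 0 < rad x <= ecc x) ->
  (exists x, ecc x = rad x) ->
  exists h : 'I_n, [/\ run hub_cmd m 13 0 = h, ecc h = rad h
    & forall x, ecc x = rad x -> rad x <= rad h].
Proof.
move=> m_n m11 m12 m14 re [c ec].
pose P (s : seq 'I_n) m' :=
  [/\ forall x : 'I_n, m' 11 x = ecc x, forall x : 'I_n, m' 12 x = rad x,
      m' 14 0 = 0 \/
        exists h : 'I_n, [/\ m' 13 0 = h, ecc h = rad h & m' 14 0 = rad h]
    & forall x, x \in s -> ecc x = rad x -> rad x <= m' 14 0].
suff [_ _ at_ ub] : P (enum 'I_n) (run hub_cmd m).
  have {}ub x : ecc x = rad x -> rad x <= run hub_cmd m 14 0.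
    by apply: ub; rewrite mem_enum.
  case: at_ => [e0|[h [e13 eh e14]]].
    by have := ub c ec; rewrite e0; have := re c; lia.
  by exists h; split=> // x ex; rewrite -e14 ub.
apply: (run_for (P := P)) => //.
- move=> s i m' _ m2 [e11 e12 at_ ub].
  rewrite !runE !evalE m2 e11 e12 !subn_eq0 -!ltnNge.
  case: ltnP => [lt|ge]; last first.
    by split=> // x; rewrite mem_rcons inE => /orP[/eqP -> //|]; exact: ub.
  case: ltnP => [lt2|ge2].
    split=> // x; rewrite mem_rcons inE => /orP[/eqP -> e|]; last exact: ub.
    by rewrite e ltnn in lt2.
  split=> //.
    right; exists i; rewrite !storeE /= m2; split=> //.
    by have := re i; lia.
  move=> x; rewrite mem_rcons inE !storeE /= => /orP[/eqP -> //|xs ex].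
  exact: leq_trans (ub _ xs ex) (ltnW lt).
- by split=> //; left.
Qed.

Definition attach_cmd : cmd :=
  CFor 2 (CIf (Bin Defs.Sub (Read 11 (var 2)) (Read 12 (var 2))) CSkip
              (link_cmd 13 2)).

Lemma run_attach m E (ecc rad : 'I_n -> nat) (h : 'I_n) : m 0 1 = n ->
  stores E m -> forest_mx E ->
  (forall x : 'I_n, m 11 x = ecc x) -> (forall x : 'I_n, m 12 x = rad x) ->
  m 13 0 = h -> ecc h = rad h -> (forall x, rad x <= ecc x) ->
  exists E', [/\ stores E' (run attach_cmd m), attaching E ecc rad h E'
    & forall x, ecc x = rad x -> E' h x != 0].
Proof.
move=> m_n mE fE m11 m12 m13 eh re.
pose P (s : seq 'I_n) m' :=
  [/\ forall x : 'I_n, m' 11 x = ecc x, forall x : 'I_n, m' 12 x = rad x,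
      m' 13 0 = h &
      exists E', [/\ stores E' m', attaching E ecc rad h E'
        & forall x, x \in s -> ecc x = rad x -> E' h x != 0]].
suff [_ _ _ [E' [mE' aE' all_h]]] : P (enum 'I_n) (run attach_cmd m).
  by exists E'; split=> // x; apply: all_h; rewrite mem_enum.
apply: (run_for (P := P)) => //.
- move=> s i m' e0 m2 [e11 e12 e13 [E' [mE' aE' all_h]]].
  rewrite run_if !evalE m2 e11 e12 subn_eq0 -ltnNge; case: ltnP => [lt|ge].
    split=> //; exists E'; split=> // x; rewrite mem_rcons inE.
    by move=> /orP[/eqP -> e|]; [rewrite e ltnn in lt | exact: all_h].
  have ei : ecc i = rad i by have := re i; lia.
  have fE' := attaching_forest aE'.
  split.
  + by move=> x; rewrite run_frame.
  + by move=> x; rewrite run_frame.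
  + by rewrite run_frame.
  exists (join E' h i); split.
  + by apply: run_link; rewrite ?e0.
  + exact: attaching_join.
  + move=> x; rewrite mem_rcons inE => /orP[/eqP -> _|xs ex].
      exact: join_conn.
    by rewrite join_id // all_h.
- split=> //; exists E; split=> //; exact: attaching_start.
Qed.

End Radii.

(** * The choice between the two trees, and the output *)

Section Output.

Variables (n : nat) (r : 'I_n -> 'I_n -> rat).
Hypothesis r_ge0 : forall i j, (0 <= r i j)%R.
Implicit Types (m : memory) (E : 'I_n -> 'I_n -> nat).

Definition test_cmd : cmd :=
  CFor 2 (CFor 3
    (CIf (exceeds_expr 2 (Bin Defs.Sub (entry 8 (var 2) (var 3)) (Const 1)))
      (CWrite 15 (Const 0) (Const 1)) CSkip)).

Lemma run_test m b E : input r m -> has_bound b m -> stores E m -> m 15 0 = 0 ->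
  if run test_cmd m 15 0 == 0
  then forall i j, (r i j * (E i j).-1%:R <= 2%:R * b)%R
  else exists i j, (2%:R * b < r i j * (E i j).-1%:R)%R.
Proof.
move=> inp hb mE m15.
pose P (s : seq ('I_n * 'I_n)) m' := [/\ has_bound b m', stores E m' &
  if m' 15 0 == 0
  then forall i j, (i, j) \in s -> (r i j * (E i j).-1%:R <= 2%:R * b)%R
  else exists i j, (2%:R * b < r i j * (E i j).-1%:R)%R].
suff [_ _] : P (pairs n) (run test_cmd m).
  by case: eqP => // _ le i j; apply: le; rewrite mem_pairs.
apply: (run_for2 (P := P)) => //.
- by case: inp.
- move=> s i j m' e m2 m3 [hb' m'E res]; have {}inp := input_eq inp e.
  rewrite !runE (eval_exceeds _ _ _ inp hb' m2 m3) // !evalE m2 m3 m'E subn1.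
  case: ltP => [lt|ge]; first by split=> //; exists i, j.
  split=> //; move: res; case: eqP => // _ le x y.
  by rewrite mem_rcons inE xpair_eqE => /orP[/andP[/eqP -> /eqP ->]|/le].
- by split=> //; rewrite m15.
Qed.

Definition push_cmd (e : expr) : cmd :=
  CSeq (CWrite 1 (Bin Add (var 1) (Const 1)) e)
       (CWrite 1 (Const 0) (Bin Add (var 1) (Const 1))).

Lemma run_push m e :
  read_output (run (push_cmd e) m) = rcons (read_output m) (eval m e).
Proof.
rewrite /read_output !runE !storeE /= !evalE !storeE /= addn1 /=.
rewrite /mkseq -addn1 iotaD map_cat cats1 /=.
congr rcons; last by rewrite !storeE /= add0n eqxx.
apply/eq_in_map => i; rewrite mem_iota => /andP[_ ilt].
by rewrite !storeE /= eqSS ltn_eqF.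
Qed.

(** The sum of the two truncated differences is the absolute difference from 2, so the value is 1
    exactly when the entry is 2. *)
Definition adj_expr : expr :=
  Bin Defs.Sub (Const 1)
    (Bin Add (Bin Defs.Sub (entry 8 (var 2) (var 3)) (Const 2))
             (Bin Defs.Sub (Const 2) (entry 8 (var 2) (var 3)))).

Definition is_zero (e : expr) : expr := Bin Defs.Sub (Const 1) e.

(** Exclusive disjunction of the two tests for node 0. *)
Definition star_expr : expr :=
  Bin Add (Bin Defs.Sub (is_zero (var 2)) (is_zero (var 3)))
          (Bin Defs.Sub (is_zero (var 3)) (is_zero (var 2))).

Definition output_cmd : cmd :=
  CFor 2 (CFor 3 (CIf (var 15) (push_cmd star_expr) (push_cmd adj_expr))).

Lemma run_output m E : m 0 1 = n -> stores E m -> m 1 0 = 0 ->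
  read_output (run output_cmd m) =
  encode_graph (if m 15 0 == 0 then adj E else @star n).
Proof.
move=> m_n mE m1.
set T := if _ then _ else _.
pose P (s : seq ('I_n * 'I_n)) m' := [/\ m' 15 0 = m 15 0, stores E m' &
  read_output m' = [seq nat_of_bool (T ij.1 ij.2) | ij <- s]].
suff [_ _ ->] : P (pairs n) (run output_cmd m).
  by rewrite /encode_graph /row_major /pairs map_allpairs.
apply: (run_for2 (P := P)) => //.
- move=> s i j m' _ m2 m3 [m'15 m'E out].
  split; first by rewrite run_frame.
    by move=> x y; rewrite run_frame.
  rewrite run_if map_rcons -out /= eval_var m'15 /T.
  case: eqVneq => _ /=; rewrite run_push !evalE m2 m3 ?m'E; congr rcons.
    by rewrite /adj; lia.
  by rewrite /star; lia.
- by split=> //; rewrite /read_output m1.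
Qed.

End Output.

(** * Layout of the input *)

Section Input.

Lemma nth_flatten_const (T : Type) (x0 : T) k (ss : seq (seq T)) i j :
  all (fun s => size s == k) ss -> j < k ->
  nth x0 (flatten ss) (i * k + j) = nth x0 (nth [::] ss i) j.
Proof.
elim: ss i => [|s ss IH] [|i] /=; rewrite ?nth_nil // => /andP[/eqP sz al] jk.
  by rewrite nth_cat sz mul0n jk.
rewrite nth_cat sz mulSn -addnA ltnNge leq_addr /= addKn; exact: IH.
Qed.

Lemma size_row_major (A : Type) n (f : 'I_n -> 'I_n -> A) :
  size (row_major f) = n * n.
Proof. by rewrite size_allpairs size_enum_ord. Qed.

Lemma nth_row_major (A : Type) (x0 : A) n (f : 'I_n -> 'I_n -> A) (i j : 'I_n) :
  nth x0 (row_major f) (i * n + j) = f i j.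
Proof.
rewrite /row_major nth_flatten_const //; last first.
  by rewrite all_map; apply/allP => a _ /=; rewrite size_map size_enum_ord.
rewrite (nth_map i) ?size_enum_ord // (nth_map j) ?size_enum_ord //.
by rewrite !nth_ord_enum.
Qed.

Lemma size_encode_rats (s : seq rat) :
  size (flatten [seq encode_rat x | x <- s]) = 2 * size s.
Proof. by elim: s => //= x s ->; rewrite mulnS. Qed.

Lemma nth_encode_rats n (f : 'I_n -> 'I_n -> rat) (i j : 'I_n) e : e < 2 ->
  nth 0 (flatten [seq encode_rat x | x <- row_major f]) (2 * (i * n + j) + e) =
  nth 0 (encode_rat (f i j)) e.
Proof.
move=> e2; rewrite mulnC nth_flatten_const //; last first.
  by apply/allP => s /mapP[a _ ->].
rewrite (nth_map 0%R) ?nth_row_major // size_row_major.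
by have := ltn_ord i; have := ltn_ord j; nia.
Qed.

Lemma load_instance (I : instance) :
  input (@req I) (load_input (encode_instance I)).
Proof.
split=> // i j; rewrite /load_input /req_addr /encode_instance /=.
set n := num_nodes I in i j *; rewrite !nth_cat size_encode_rats size_row_major.
have e0 : 2 * (n * n + (i * n + j)) = 2 * (n * n) + (2 * (i * n + j) + 0) by lia.
have e1 : 2 * (n * n + (i * n + j)) + 1 = 2 * (n * n) + (2 * (i * n + j) + 1) by lia.
by rewrite e1 e0 ?add0n !ltnNge !leq_addr /= !addKn !nth_encode_rats.
Qed.

End Input.

Definition main_cmd : cmd :=
  CSeq init_cmd (CSeq max_cmd (CSeq forest_cmd (CSeq ecc_cmd (CSeq rad_cmd
    (CSeq hub_cmd (CSeq attach_cmd (CSeq test_cmd output_cmd))))))).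

Lemma run_tree n (r : 'I_n -> 'I_n -> rat) b m E : input r m ->
  (forall a i, a \in [:: 11; 12; 13; 14] -> m a i = 0) ->
  stores E m -> forest_mx E ->
  (forall i j, adj E i j -> (b <= r i j)%R) ->
  (forall i j, (b <= r i j)%R -> E i j != 0) ->
  exists E',
  [/\ stores E' (run attach_cmd (run hub_cmd (run rad_cmd (run ecc_cmd m)))),
    forest_mx E', forall i j, E' i j != 0 &
    forall T, is_spanning_tree T ->
      (forall i j, i != j -> (b <= r i j)%R -> T i j) ->
      (forall i j, i != j -> (b <= r i j)%R -> adj E' i j) /\
      (forall i j, exists i' j', E' i j <= (hop T i' j').+1)].
Proof.
move=> inp zero mE fE low high; have m_n := proj1 inp.
case: (pickP (fun _ : 'I_n => true)) => [x0 _|no]; last first.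
  exists E; split=> //.
  - by move=> i; have := no i.
  - by move=> i; have := no i.
  - by move=> T _ _; split=> i; have := no i.
have [|ecc_ub ecc_at] := run_ecc m_n mE fE.
  by move=> a; apply: zero.
set m1 := run ecc_cmd m in ecc_ub ecc_at *.
pose ecc (x : 'I_n) := m1 11 x.
have m1_n : m1 0 1 = n by rewrite /m1 run_frame.
have m1E : stores E m1 by move=> x y; rewrite /m1 run_frame.
have [rad_lb rad_at] := run_rad (ecc := ecc) m1_n m1E fE (fun _ => erefl).
set m2 := run rad_cmd m1 in rad_lb rad_at *.
pose rad (x : 'I_n) := m2 12 x.
have m2_n : m2 0 1 = n by rewrite /m2 run_frame.
have m2E : stores E m2 by move=> x y; rewrite /m2 run_frame.
have m2_11 (x : 'I_n) : m2 11 x = ecc x by rewrite /m2 run_frame.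
have re x : rad x <= ecc x by apply: rad_lb; rewrite fmx_diag.
have r0 x : 0 < rad x.
  rewrite /rad; have [c _ <-] := rad_at x.
  by apply: leq_trans (ecc_ub c c); rewrite fmx_diag.
have [|||h [m3_13 eh hmax]] :=
    run_hub (m := m2) (ecc := ecc) (rad := rad) x0 m2_n m2_11 (fun _ => erefl).
- by rewrite /m2 /m1 !run_frame // zero.
- by move=> x; rewrite r0 re.
- have [c xc ec] := rad_at x0; exists c.
  rewrite ec; exact: (rad_component (rad := rad) fE rad_lb rad_at xc).
set m3 := run hub_cmd m2 in m3_13 *.
have m3_n : m3 0 1 = n by rewrite /m3 run_frame.
have m3E : stores E m3 by move=> x y; rewrite /m3 run_frame.
have m3_11 (x : 'I_n) : m3 11 x = ecc x by rewrite /m3 run_frame.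
have m3_12 (x : 'I_n) : m3 12 x = rad x by rewrite /m3 run_frame.
have [E' [mE' aE' all_h]] :=
  run_attach m3_n m3E fE m3_11 m3_12 m3_13 eh re.
have connE' := attaching_connected fE rad_at rad_lb aE' all_h.
have [fE' ext center _] := aE'.
exists E'; split=> // T treeT highT.
have adjT : subrel (adj E) T.
  move=> i j ij; apply: highT (low _ _ ij).
  by apply: contraTneq ij => ->; rewrite adj_irr.
split=> i j; last first.
  apply: (hub_tree_diameter fE treeT adjT ecc_ub ecc_at rad_lb rad_at fE' connE'
    ext eh hmax) => x ex.
  exact: center (all_h _ ex).
(* The pair is connected in the forest, whose distances are those of [T], and it is an edge of [T];
   so it is an edge of the forest. *)
move=> ij bij; rewrite /adj ext ?high // (fmx_hop_super fE treeT adjT) ?high //.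
have [sT _ _ aT] := treeT.
have := hop_gt0 treeT ij; have := hop_walk sT aT (x := i) (p := [:: j]).
by rewrite /= highT // => /(_ isT); lia.
Qed.

Lemma run_main (I : instance) : uniform_dist I -> at_most_two_req I ->
  encodes_min_tree I (read_output (run main_cmd (load_input (encode_instance I)))).
Proof.
move=> unif two; have inp0 := load_instance I.
set m0 := load_input _ in inp0 *.
have zero a i : a != 0 -> m0 a i = 0 by rewrite /m0 /load_input => /negbTE ->.
clearbody m0; set n := num_nodes I in inp0 *; have m0_n := proj1 inp0.
rewrite /main_cmd !run_seq.
have m1E := run_init m0_n (fun i => zero 8 i isT).
set m1 := run init_cmd m0 in m1E *.
have inp1 : input (@req I) m1 by apply: input_eq inp0 _ => a; rewrite /m1 run_frame.
have [|b [hb le_b at_b]] := run_max (@req_ge0 I) inp1.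
  by rewrite /m1 run_frame // zero.
set m2 := run max_cmd m1 in hb *.
have inp2 : input (@req I) m2 by apply: input_eq inp1 _ => a; rewrite /m2 run_frame.
have m2E : stores (fun x y : 'I_n => (x == y) : nat) m2.
  by move=> x y; rewrite /m2 run_frame.
have [|E [m3E fE low high]] := run_forest (@req_ge0 I) (@req_sym I) inp2 hb m2E
    (discrete_forest_mx _).
  by move=> i j; rewrite /adj; case: (i == j).
set m3 := run forest_cmd m2 in m3E *.
have inp3 : input (@req I) m3 by apply: input_eq inp2 _ => a; rewrite /m3 run_frame.
have [|E' [mE' fE' connE' opt]] := run_tree inp3 _ m3E fE low high.
  by move=> a i; rewrite !inE => /or4P[] /eqP ->;
  rewrite /m3 /m2 /m1 !run_frame // zero.
set m7 := run attach_cmd _ in mE' *.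
have inp7 : input (@req I) m7 by apply: input_eq inp3 _ => a; rewrite /m7 !run_frame.
have hb7 : has_bound b m7 by rewrite /has_bound /m7 /m3 !run_frame.
have m7_15 : m7 15 0 = 0 by rewrite /m7 /m3 /m2 /m1 !run_frame // zero.
have := run_test (@req_ge0 I) inp7 hb7 mE' m7_15.
have m8_n : run test_cmd m7 0 1 = n by rewrite run_frame // (proj1 inp7).
have m8E : stores E' (run test_cmd m7) by move=> x y; rewrite run_frame.
rewrite (run_output m8_n m8E); last first.
  by rewrite run_frame // /m7 /m3 /m2 /m1 !run_frame // zero.
have le_b' (i j : 'I_(num_nodes I)) : i != j -> (req i j <= b)%R.
  by rewrite -val_eqE neq_ltn => /orP[ij|ji]; [|rewrite req_sym]; apply: le_b.
have opt1 T tT hT := proj1 (opt T tT hT).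
have opt2 T tT hT := proj2 (opt T tT hT).
case: eqP => _ test; eexists; split; try reflexivity.
  by apply: (hub_tree_min (@dist_ge0 I) unif (@req_ge0 I) two at_b fE' connE'
    opt1 opt2) => i j _; exact: test.
apply: (star_min (@dist_ge0 I) unif (@req_ge0 I) two le_b' at_b fE' connE'
  (star_spanning_tree _) (@star_hop _) opt1 opt2).
have [i [j lt]] := test; exists i, j; split=> //.
(* The test ran over all pairs, but a diagonal one has distance 0 and cannot exceed [2 * b]. *)
apply: contraTneq lt => ->; rewrite fmx_diag // mulr0 -leNgt.
by rewrite mulr_ge0 ?(b_ge0 (@req_ge0 I) at_b).
Qed.

Theorem lemma6p3 :
  poly_time_solvable encode_instance
    (fun I : instance => uniform_dist I /\ at_most_two_req I)
    encodes_min_tree.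
Proof.
apply: (poly_time_run (c := main_cmd)) => // I.
- rewrite /encode_instance /= size_cat !size_encode_rats !size_row_major; nia.
- by case; exact: run_main.
Qed.
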